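(* (Explicit $K_\epsilon$-Iwasawa decomposition of $\mathrm F_{4(-20)}$.) One has $$K_\epsilon AN^+=\{g\in\mathrm F_{4(-20)}:(gP^-|E_2)\neq0\}=\{g\in\mathrm F_{4(-20)}:(gP^-|E_2)>0\},$$ and $K_\epsilon AN^+$ is an open dense submanifold of $\mathrm F_{4(-20)}$. For every $g\in K_\epsilon AN^+$ there exist unique $k_\epsilon(g)\in K_\epsilon$, $H_\epsilon(g)\in\mathfrak a$ and $n_\epsilon(g)\in N^+$ such that $g=k_\epsilon(g)(\exp H_\epsilon(g))n_\epsilon(g)$, and they are given by (i) $H_\epsilon(g)=\tfrac12\log\bigl((gP^-|E_2)\bigr)\tilde A_3^1(1)$, (ii) $n_\epsilon(g)=\exp\Bigl(\mathcal G_1\bigl(\tfrac12\bigl(\sum_{i=0}^7(gQ^+(e_i)|E_2)e_i\bigr)/(gP^-|E_2)\bigr)+\mathcal G_2\bigl(-\tfrac12\bigl(\sum_{i=1}^7(gF_3^1(e_i)|E_2)e_i\bigr)/(gP^-|E_2)\bigr)\Bigr)$, (iii) $k_\epsilon(g)=g\,n_\epsilon(g)^{-1}\exp(-H_\epsilon(g))$.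
   Context: Octonions: $\mathbf O$ is the real division algebra of octonions with standard basis $1=e_0,e_1,\dots,e_7$, conjugation $x\mapsto\overline x$, inner product $(x|y)=\mathrm{Re}(x\overline y)$, and $\mathrm{Im}\,\mathbf O=\mathrm{span}_{\mathbb R}(e_1,\dots,e_7)$. Jordan algebra: for $\xi_i\in\mathbb R$, $x_i\in\mathbf O$ let $$h^1(\xi_1,\xi_2,\xi_3;x_1,x_2,x_3)=\begin{pmatrix}\xi_1&\sqrt{-1}x_3&\sqrt{-1}\,\overline{x_2}\\ \sqrt{-1}\,\overline{x_3}&\xi_2&x_1\\ \sqrt{-1}x_2&\overline{x_1}&\xi_3\end{pmatrix}$$ (entries in $\mathbf O\otimes_{\mathbb R}\mathbb C$). $\mathcal J^1$ is the real vector space of all these matrices, with Jordan product $X\circ Y=\frac12(XY+YX)$, trace $\mathrm{tr}(X)=\xi_1+\xi_2+\xi_3$ and bilinear form $(X|Y)=\mathrm{tr}(X\circ Y)=\sum\xi_i\eta_i+2(x_1|y_1)-2(x_2|y_2)-2(x_3|y_3)$. $E_i=h^1(\delta_{i1},\delta_{i2},\delta_{i3};0,0,0)$, $F_i^1(x)=h^1(0,0,0;\delta_{i1}x,\delta_{i2}x,\delta_{i3}x)$, $P^-=h^1(-1,1,0;0,0,1)$, $Q^+(x)=h^1(0,0,0;x,\overline x,0)$. Group: $\mathrm F_{4(-20)}=\{g\in \mathrm{GL}_{\mathbb R}(\mathcal J^1): g(X\circ Y)=gX\circ gY\}$, with Lie algebra $\mathfrak f_{4(-20)}$; $\exp$ is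 the exponential of linear maps. Operators in $\mathfrak f_{4(-20)}$: for $a\in\mathbf O$, on $X=h^1(\xi_1,\xi_2,\xi_3;x_1,x_2,x_3)$, $\tilde A_1^1(a)X=h^1(0,2(a|x_1),-2(a|x_1);-(\xi_2-\xi_3)a,-\overline{x_3a},\overline{ax_2})$, $\tilde A_2^1(a)X=h^1(2(a|x_2),0,-2(a|x_2);-\overline{ax_3},-(\xi_3-\xi_1)a,-\overline{x_1a})$, $\tilde A_3^1(a)X=h^1(-2(a|x_3),2(a|x_3),0;\overline{x_2a},\overline{ax_1},-(\xi_1-\xi_2)a)$; for $p\in\mathrm{Im}\,\mathbf O$, $\delta(p)X=h^1(0,0,0;px_1,x_2p,-(px_3+x_3p))$. Put $\mathcal G_1(x)=\tilde A_1^1(x)+\tilde A_2^1(-\overline x)$ and $\mathcal G_2(p)=\tilde A_3^1(-p)-\delta(p)$. Subgroups: $\mathfrak a=\mathbb R\tilde A_3^1(1)$, $A=\exp\mathfrak a$; $N^+=\{\exp(\mathcal G_1(x)+\mathcal G_2(p)):x\in\mathbf O,\ p\in\mathrm{Im}\,\mathbf O\}$; $K_\epsilon=\{g\in\mathrm F_{4(-20)}:gE_2=E_2\}$ (isomorphic to $\mathrm{Spin}^0(8,1)$). *)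

(* Defs.v *)
From HB Require Import structures.
From mathcomp Require Import all_boot all_order all_algebra.
From mathcomp Require Import complex.
From mathcomp Require Import all_classical all_reals all_analysis.
From mathcomp Require Import ring.
Set Implicit Arguments.
Unset Strict Implicit.
Unset Printing Implicit Defensive.
Import Order.TTheory GRing.Theory Num.Theory.
Import numFieldNormedType.Exports.
Local Open Scope classical_set_scope.
Local Open Scope ring_scope.

(* Octonions with coefficients in K, as coordinate vectors on e_0 = 1, e_1,
   ..., e_7.  The real octonions are [oct R], and [oct R[i]] is the
   complexification of [oct R]. *)
Notation oct K := 'rV[K]_8.

Section Octonions.
Variable K : comNzRingType.
Implicit Types x y : oct K.

Definition oe (i : 'I_8) : oct K := delta_mx 0 i.

(* The imaginary units are indexed by 1, ..., 7, cyclically; the product is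
   determined by e_i e_(i+1) = e_(i+3) and its cyclic permutations, where
   i+1 and i+3 are reduced modulo 7. *)
Definition shift7 (k : 'I_8) (m : nat) : 'I_8 := inord ((k + m).-1 %% 7).+1.

Definition omul x y : oct K := \row_(k < 8)
  let d i j := x 0 i * y 0 j - x 0 j * y 0 i in
  if k == 0 then x 0 0 * y 0 0 - \sum_(i < 8 | i != 0) x 0 i * y 0 i
  else x 0 0 * y 0 k + x 0 k * y 0 0
       + d (shift7 k 1) (shift7 k 3)
       + d (shift7 k 2) (shift7 k 6)
       + d (shift7 k 4) (shift7 k 5).

Definition oconj x : oct K := \row_k (if k == 0 then x 0 k else - x 0 k).

Definition ore x : K := x 0 0.

Definition oip x y : K := ore (omul x (oconj y)).

Definition oIm x : Prop := ore x = 0.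

Lemma oct_eqP x y : (forall j, (j < 8)%N -> x 0 (inord j) = y 0 (inord j)) -> x = y.
Proof. by move=> h; apply/rowP => k; rewrite -(inord_val k); exact: h. Qed.

Lemma inord8_0 : inord 0 = 0 :> 'I_8.
Proof. by apply: val_inj; rewrite /= inordK. Qed.

Lemma inord8_eq0 j : (j < 8)%N -> (inord j == 0 :> 'I_8) = (j == 0)%N.
Proof. by move=> j8; rewrite -val_eqE /= inordK. Qed.

Lemma shift7E j m : (j < 8)%N -> shift7 (inord j) m = inord ((j + m).-1 %% 7).+1.
Proof. by move=> j8; rewrite /shift7 inordK. Qed.

Lemma omulE x y (j : nat) :
  let c (z : oct K) i := z 0 (inord i : 'I_8) in
  let d i j := c x i * c y j - c x j * c y i in
  (j < 8)%N -> omul x y 0 (inord j) = nth 0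
   [:: c x 0%N * c y 0%N - c x 1%N * c y 1%N - c x 2%N * c y 2%N
         - c x 3%N * c y 3%N - c x 4%N * c y 4%N - c x 5%N * c y 5%N
         - c x 6%N * c y 6%N - c x 7%N * c y 7%N;
       c x 0%N * c y 1%N + c x 1%N * c y 0%N + d 2%N 4%N + d 3%N 7%N + d 5%N 6%N;
       c x 0%N * c y 2%N + c x 2%N * c y 0%N + d 3%N 5%N + d 4%N 1%N + d 6%N 7%N;
       c x 0%N * c y 3%N + c x 3%N * c y 0%N + d 4%N 6%N + d 5%N 2%N + d 7%N 1%N;
       c x 0%N * c y 4%N + c x 4%N * c y 0%N + d 5%N 7%N + d 6%N 3%N + d 1%N 2%N;
       c x 0%N * c y 5%N + c x 5%N * c y 0%N + d 6%N 1%N + d 7%N 4%N + d 2%N 3%N;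
       c x 0%N * c y 6%N + c x 6%N * c y 0%N + d 7%N 2%N + d 1%N 5%N + d 3%N 4%N;
       c x 0%N * c y 7%N + c x 7%N * c y 0%N + d 1%N 3%N + d 2%N 6%N + d 4%N 5%N] j.
Proof.
move=> c d j8; rewrite !mxE inord8_eq0 // !shift7E // /d /c.
case: j j8 => [_|j j8] /=.
  rewrite -inord8_0 (eq_bigr (fun i : 'I_8 => c x (val i) * c y (val i))); last first.
    by move=> i _; rewrite /c inord_val.
  by rewrite inord8_0 big_mkcond !big_ord_recl big_ord0 /= /c; ring.
rewrite -inord8_0; by do 7 (case: j j8 => [_ //=|j j8]).
Qed.

Lemma oconjE x j : (j < 8)%N ->
  oconj x 0 (inord j) = if j == 0%N then x 0 (inord j) else - x 0 (inord j).
Proof. by move=> j8; rewrite mxE inord8_eq0. Qed.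

Lemma octD x y i : (x + y) 0 i = x 0 i + y 0 i. Proof. by rewrite mxE. Qed.
Lemma octN x i : (- x) 0 i = - x 0 i. Proof. by rewrite mxE. Qed.
Lemma octZ c x i : (c *: x) 0 i = c * x 0 i. Proof. by rewrite mxE. Qed.
Lemma oe0E j : (j < 8)%N -> oe 0 0 (inord j) = (j == 0)%N%:R.
Proof. by move=> j8; rewrite mxE eqxx inord8_eq0. Qed.

Ltac oct_ring := apply: oct_eqP;
  do 8 (case=> [_|];
    first by rewrite ?(octD, octN, octZ, oe0E, omulE, oconjE) //=; ring); by [].

Lemma oip_sum x y : oip x y = \sum_i x 0 i * y 0 i.
Proof.
rewrite (eq_bigr (fun i : 'I_8 => x 0 (inord (val i)) * y 0 (inord (val i)))); last first.
  by move=> i _; rewrite inord_val.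
rewrite !big_ord_recl big_ord0 /= /oip /ore -inord8_0 omulE //= !oconjE //=; ring.
Qed.

(* The norm is multiplicative, so this is the octonion algebra. *)
Lemma oip_omul x y : oip (omul x y) (omul x y) = oip x x * oip y y.
Proof.
have oipE (z : oct K) : oip z z = \sum_(i < 8) z 0 (inord i) * z 0 (inord i).
  by rewrite oip_sum; apply: eq_bigr => i _; rewrite inord_val.
rewrite !oipE !big_ord_recl !big_ord0 /= !omulE //=; ring.
Qed.

Lemma oconj_mul x y : oconj (omul x y) = omul (oconj y) (oconj x).
Proof. oct_ring. Qed.

Lemma omulDl x y z : omul (x + y) z = omul x z + omul y z.
Proof. oct_ring. Qed.
Lemma omulDr x y z : omul z (x + y) = omul z x + omul z y.
Proof. oct_ring. Qed.
Lemma omulZl c x y : omul (c *: x) y = c *: omul x y.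
Proof. oct_ring. Qed.
Lemma omulZr c x y : omul x (c *: y) = c *: omul x y.
Proof. oct_ring. Qed.
Lemma omul_oneP x : omul (oe 0) x = x /\ omul x (oe 0) = x.
Proof. by split; oct_ring. Qed.

End Octonions.

Declare Scope oct_scope.
Delimit Scope oct_scope with oct.
Notation "x * y" := (omul x y) : oct_scope.

Section Jordan.
Variable R : realType.
Implicit Types (a p x : oct R) (t : R).

Definition ocplx x : oct R[i] := map_mx (fun t => Complex t 0) x.
Definition oimag x : oct R[i] := map_mx (fun t => Complex 0 t) x.

(* J^1 is identified with R^27 through the coordinates
   (xi_1, xi_2, xi_3; x_1, x_2, x_3) of h^1. *)
Definition J1 := 'cV[R]_27.

Definition h1 (t1 t2 t3 : R) (x1 x2 x3 : oct R) : J1 :=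
  col_mx (\col_(i < 3) nth 0 [:: t1; t2; t3] i)
         (col_mx x1^T (col_mx x2^T x3^T)).

Definition xi1 (X : J1) : R := X (inord 0) 0.
Definition xi2 (X : J1) : R := X (inord 1) 0.
Definition xi3 (X : J1) : R := X (inord 2) 0.
Definition ox1 (X : J1) : oct R := \row_(k < 8) X (inord (3 + k)) 0.
Definition ox2 (X : J1) : oct R := \row_(k < 8) X (inord (11 + k)) 0.
Definition ox3 (X : J1) : oct R := \row_(k < 8) X (inord (19 + k)) 0.

(* The 3 x 3 matrix over the complexified octonions that h^1 denotes. *)
Definition h1_mx (X : J1) : 'M[oct R[i]]_3 :=
  let s t := ocplx (t *: oe R 0) in
  \matrix_(i < 3, j < 3) nth 0 (nth [::]
    [:: [:: s (xi1 X); oimag (ox3 X); oimag (oconj (ox2 X))];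
        [:: oimag (oconj (ox3 X)); s (xi2 X); ocplx (ox1 X)];
        [:: oimag (ox2 X); ocplx (oconj (ox1 X)); s (xi3 X)]]
    i) j.

Definition omx_mul (A B : 'M[oct R[i]]_3) : 'M[oct R[i]]_3 :=
  \matrix_(i, j) \sum_k (A i k * B k j)%oct.

Definition omx_jordan (A B : 'M[oct R[i]]_3) : 'M[oct R[i]]_3 :=
  map_mx (fun z : oct R[i] => 2^-1 *: z) (omx_mul A B + omx_mul B A).

(* Left inverse of [h1_mx]: reads the coordinates off a matrix.  The matrices
   [h1_mx X] are closed under [omx_jordan] (lemma [h1_mx_jordan]), so that
   [jordan] below is the Jordan product of J^1. *)
Definition h1_coord (M : 'M[oct R[i]]_3) : J1 :=
  let re := map_mx (@complex.Re R) in
  let im := map_mx (@complex.Im R) in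
  h1 (ore (re (M 0 0))) (ore (re (M 1 1))) (ore (re (M 2%:R 2%:R)))
     (re (M 1 2%:R)) (im (M 2%:R 0)) (im (M 0 1)).

Definition jordan (X Y : J1) : J1 := h1_coord (omx_jordan (h1_mx X) (h1_mx Y)).

Definition trJ (X : J1) : R := xi1 X + xi2 X + xi3 X.

Definition ipJ (X Y : J1) : R := trJ (jordan X Y).

Definition E2 : J1 := h1 0 1 0 0 0 0.
Definition F3 x : J1 := h1 0 0 0 0 0 x.
Definition Pminus : J1 := h1 (-1) 1 0 0 0 (oe R 0).
Definition Qplus x : J1 := h1 0 0 0 x (oconj x) 0.

(* Linear endomorphisms of J^1 are matrices acting on columns; composition
   is the matrix product. *)
Definition endJ := 'M[R]_27.

Definition lin_mat (f : J1 -> J1) : endJ := \matrix_(i, j) f (delta_mx j 0) i 0.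

Definition expJ (T : endJ) : endJ :=
  limn (series (fun n => (n`!%:R)^-1 *: T ^+ n)).

Definition F4 : set endJ :=
  [set g | g \in unitmx /\
           forall X Y, g *m jordan X Y = jordan (g *m X) (g *m Y)].

Definition A1_fun a (X : J1) : J1 :=
  h1 0 (2 * oip a (ox1 X)) (- (2 * oip a (ox1 X)))
     (- ((xi2 X - xi3 X) *: a))
     (- oconj (ox3 X * a)%oct)
     (oconj (a * ox2 X)%oct).

Definition A2_fun a (X : J1) : J1 :=
  h1 (2 * oip a (ox2 X)) 0 (- (2 * oip a (ox2 X)))
     (- oconj (a * ox3 X)%oct)
     (- ((xi3 X - xi1 X) *: a))
     (- oconj (ox1 X * a)%oct).

Definition A3_fun a (X : J1) : J1 :=
  h1 (- (2 * oip a (ox3 X))) (2 * oip a (ox3 X)) 0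
     (oconj (ox2 X * a)%oct)
     (oconj (a * ox1 X)%oct)
     (- ((xi1 X - xi2 X) *: a)).

Definition delta_fun p (X : J1) : J1 :=
  h1 0 0 0 (p * ox1 X)%oct (ox2 X * p)%oct
     (- ((p * ox3 X)%oct + (ox3 X * p)%oct)).

Definition A1 a : endJ := lin_mat (A1_fun a).
Definition A2 a : endJ := lin_mat (A2_fun a).
Definition A3 a : endJ := lin_mat (A3_fun a).
Definition deltaJ p : endJ := lin_mat (delta_fun p).

Definition G1 x : endJ := A1 x + A2 (- oconj x).
Definition G2 p : endJ := A3 (- p) - deltaJ p.

Definition lie_a : set endJ := [set t *: A3 (oe R 0) | t in [set: R]].
Definition groupA : set endJ := [set expJ H | H in lie_a].
Definition Nplus : set endJ :=
  [set n | exists x p : oct R, oIm p /\ n = expJ (G1 x + G2 p)].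
Definition Keps : set endJ := [set g | F4 g /\ g *m E2 = E2].
Definition KAN : set endJ :=
  [set g | exists k a n : endJ, [/\ Keps k, groupA a, Nplus n & g = k *m a *m n]].

Definition iwasawa (g k H n : endJ) : Prop :=
  [/\ Keps k, lie_a H, Nplus n & g = k *m expJ H *m n].

Definition H_eps (g : endJ) : endJ :=
  (2^-1 * ln (ipJ (g *m Pminus) E2)) *: A3 (oe R 0).

Definition n_eps (g : endJ) : endJ :=
  let m := ipJ (g *m Pminus) E2 in
  expJ (G1 ((2^-1 / m) *: \sum_(i < 8) ipJ (g *m Qplus (oe R i)) E2 *: oe R i)
      + G2 (- (2^-1 / m) *:
             \sum_(i < 8 | i != 0) ipJ (g *m F3 (oe R i)) E2 *: oe R i)).

Definition k_eps (g : endJ) : endJ := g *m invmx (n_eps g) *m expJ (- H_eps g).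

End Jordan.

Section JordanFacts.
Variable R : realType.
Implicit Types x y : oct R.

Lemma h1E (t1 t2 t3 : R) x1 x2 x3 : let X := h1 t1 t2 t3 x1 x2 x3 in
  [/\ xi1 X = t1, xi2 X = t2 & xi3 X = t3] /\ [/\ ox1 X = x1, ox2 X = x2 & ox3 X = x3].
Proof.
have lo j (j3 : (j < 3)%N) : h1 t1 t2 t3 x1 x2 x3 (inord j) 0 = nth 0 [:: t1; t2; t3] j.
  have -> : inord j = lshift (8 + (8 + 8)) (Ordinal j3) :> 'I_27.
    by apply: val_inj; rewrite /= inordK // (ltn_trans j3).
  by apply: etrans (col_mxEu _ _ _ _) _; rewrite mxE.
have b27 m (k : 'I_8) : (m <= 19)%N -> (m + k < 27)%N.
  by move=> m19; apply: leq_ltn_trans (leq_add m19 (leqnn k)) _; rewrite (ltn_add2l 19 k 8).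
do 2 split; rewrite /xi1 /xi2 /xi3 ?lo //; apply/rowP => k; rewrite mxE.
- have -> : inord (3 + k) = rshift 3 (lshift (8 + 8) k) :> 'I_27.
    by apply: val_inj; rewrite /= inordK ?b27.
  by apply: etrans (col_mxEd _ _ _ _) _; apply: etrans (col_mxEu _ _ _ _) _; rewrite mxE.
- have -> : inord (11 + k) = rshift 3 (rshift 8 (lshift 8 k)) :> 'I_27.
    by apply: val_inj; rewrite /= inordK ?b27.
  by do 2! [apply: etrans (col_mxEd _ _ _ _) _]; apply: etrans (col_mxEu _ _ _ _) _; rewrite mxE.
- have -> : inord (19 + k) = rshift 3 (rshift 8 (rshift 8 k)) :> 'I_27.
    by apply: val_inj; rewrite /= inordK ?b27.
  by do 3! [apply: etrans (col_mxEd _ _ _ _) _]; rewrite mxE.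
Qed.

Lemma J1P (X Y : J1 R) : [/\ xi1 X = xi1 Y, xi2 X = xi2 Y & xi3 X = xi3 Y] ->
  [/\ ox1 X = ox1 Y, ox2 X = ox2 Y & ox3 X = ox3 Y] -> X = Y.
Proof.
move=> [e1 e2 e3] [/rowP f1 /rowP f2 /rowP f3].
apply/matrixP => i j; rewrite ord1 {j}.
rewrite -(inord_val i); case: i => j /= j27.
case: (ltnP j 3) => [|j3].
  by case: j j27 => [|[|[|//]]].
case: (ltnP j 11) => [j11|j11].
  have h : (j - 3 < 8)%N by rewrite ltn_subLR.
  by have := f1 (Ordinal h); rewrite !mxE /= subnKC.
case: (ltnP j 19) => [j19|j19].
  have h : (j - 11 < 8)%N by rewrite ltn_subLR.
  by have := f2 (Ordinal h); rewrite !mxE /= subnKC.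
have h : (j - 19 < 8)%N by rewrite ltn_subLR.
by have := f3 (Ordinal h); rewrite !mxE /= subnKC.
Qed.

Lemma ocplxE x i : ocplx x 0 i = Complex (x 0 i) 0. Proof. by rewrite mxE. Qed.

Lemma ocplx_add x y : ocplx x + ocplx y = ocplx (x + y).
Proof. by apply/rowP => i; rewrite !mxE; simpc. Qed.
Lemma oimag_add x y : oimag x + oimag y = oimag (x + y).
Proof. by apply/rowP => i; rewrite !mxE; simpc. Qed.
Lemma oimagE x : oimag x = Complex 0 1 *: ocplx x.
Proof. by apply/rowP => i; rewrite !mxE; simpc. Qed.
Lemma ocplxM x y : (ocplx x * ocplx y)%oct = ocplx (x * y)%oct.
Proof.
apply/rowP => k; rewrite !mxE.
have cM a b : Complex a 0 * Complex b 0 = Complex (a * b) 0 :> R[i] by simpc.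
have cD a b : Complex a 0 + Complex b 0 = Complex (a + b) 0 :> R[i] by simpc.
have cN a : - Complex a 0 = Complex (- a) 0 :> R[i] by simpc.
have cS : \sum_(i < 8 | i != 0) ocplx x 0 i * ocplx y 0 i
   = Complex (\sum_(i < 8 | i != 0) x 0 i * y 0 i) 0.
  apply: (big_rec2 (fun (a : R[i]) b => a = Complex b 0)) => // i a b _ ->; by rewrite !ocplxE cM cD.
case: (k == 0); first by rewrite cS ?ocplxE cM cN cD.
by rewrite /= ?ocplxE !(cM, cN, cD).
Qed.
Lemma ocplx_imM x y : (ocplx x * oimag y)%oct = oimag (x * y)%oct.
Proof. by rewrite !oimagE omulZr ocplxM. Qed.
Lemma oim_cplxM x y : (oimag x * ocplx y)%oct = oimag (x * y)%oct.
Proof. by rewrite !oimagE omulZl ocplxM. Qed.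
Lemma oimagM x y : (oimag x * oimag y)%oct = ocplx (- (x * y)%oct).
Proof.
rewrite !oimagE omulZl omulZr ocplxM scalerA; apply/rowP => i; rewrite !mxE; simpc => //.
Qed.
Lemma half_ocplx x : 2^-1 *: ocplx x = ocplx (2^-1 *: x).
Proof.
have e : (2^-1 : R[i]) = Complex 2^-1 0.
  by rewrite -[RHS]/((2^-1)%:C)%C fmorphV rmorph_nat.
by rewrite e; apply/rowP => i; rewrite !mxE; simpc.
Qed.
Lemma half_oimag x : 2^-1 *: oimag x = oimag (2^-1 *: x).
Proof.
rewrite !oimagE scalerA mulrC -scalerA half_ocplx //.
Qed.
Lemma re_ocplx x : map_mx (@complex.Re R) (ocplx x) = x.
Proof. by apply/rowP => i; rewrite !mxE. Qed.
Lemma im_oimag x : map_mx (@complex.Im R) (oimag x) = x.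
Proof. by apply/rowP => i; rewrite !mxE. Qed.

Lemma oconjK x : oconj (oconj x) = x.
Proof. by apply/rowP => i; rewrite !mxE; case: (i == 0); rewrite ?opprK. Qed.
Lemma oconjD x y : oconj (x + y) = oconj x + oconj y.
Proof. by apply/rowP => i; rewrite !mxE; case: (i == 0) => //; rewrite opprD. Qed.
Lemma oconjN x : oconj (- x) = - oconj x.
Proof. by apply/rowP => i; rewrite !mxE; case: (i == 0). Qed.
Lemma oconjZ c x : oconj (c *: x) = c *: oconj x.
Proof. by apply/rowP => i; rewrite !mxE; case: (i == 0) => //; rewrite mulrN. Qed.
Lemma oconj_sum x y : (x * oconj y)%oct + (y * oconj x)%oct = (2 * oip x y) *: oe R 0.
Proof.
have -> : (y * oconj x)%oct = oconj (x * oconj y)%oct by rewrite oconj_mul oconjK.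
rewrite /oip; move: (x * _)%oct => z; apply/rowP => i; rewrite !mxE /=.
by rewrite ?eqxx /=; case: (i =P 0) => [->|_] /=; rewrite ?mulr1n ?mulr0n /ore; ring.
Qed.
Lemma oip_conj x y : oip (oconj x) (oconj y) = oip x y.
Proof.
rewrite !oip_sum; apply: eq_bigr => i _; rewrite !mxE; case: (i == 0) => //.
by rewrite mulrNN.
Qed.
Lemma oconj_suml x y : (oconj x * y)%oct + (oconj y * x)%oct = (2 * oip x y) *: oe R 0.
Proof. by rewrite -{1}(oconjK y) -{2}(oconjK x) oconj_sum oip_conj. Qed.

Definition jordan_h1 (X Y : J1 R) : J1 R :=
  h1 (xi1 X * xi1 Y - oip (ox2 X) (ox2 Y) - oip (ox3 X) (ox3 Y))
     (xi2 X * xi2 Y + oip (ox1 X) (ox1 Y) - oip (ox3 X) (ox3 Y))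
     (xi3 X * xi3 Y + oip (ox1 X) (ox1 Y) - oip (ox2 X) (ox2 Y))
     (2^-1 *: ((xi2 X + xi3 X) *: ox1 Y + (xi2 Y + xi3 Y) *: ox1 X
         - oconj ((ox2 X * ox3 Y)%oct + (ox2 Y * ox3 X)%oct)))
     (2^-1 *: ((xi1 X + xi3 X) *: ox2 Y + (xi1 Y + xi3 Y) *: ox2 X
         + oconj ((ox3 X * ox1 Y)%oct + (ox3 Y * ox1 X)%oct)))
     (2^-1 *: ((xi1 X + xi2 X) *: ox3 Y + (xi1 Y + xi2 Y) *: ox3 X
         + oconj ((ox1 X * ox2 Y)%oct + (ox1 Y * ox2 X)%oct))).

Lemma omx_jordanE (X Y : J1 R) :
  omx_jordan (h1_mx X) (h1_mx Y) = h1_mx (jordan_h1 X Y).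
Proof.
have [[e1 e2 e3] [f1 f2 f3]] := h1E
     (xi1 X * xi1 Y - oip (ox2 X) (ox2 Y) - oip (ox3 X) (ox3 Y))
     (xi2 X * xi2 Y + oip (ox1 X) (ox1 Y) - oip (ox3 X) (ox3 Y))
     (xi3 X * xi3 Y + oip (ox1 X) (ox1 Y) - oip (ox2 X) (ox2 Y))
     (2^-1 *: ((xi2 X + xi3 X) *: ox1 Y + (xi2 Y + xi3 Y) *: ox1 X
         - oconj ((ox2 X * ox3 Y)%oct + (ox2 Y * ox3 X)%oct)))
     (2^-1 *: ((xi1 X + xi3 X) *: ox2 Y + (xi1 Y + xi3 Y) *: ox2 X
         + oconj ((ox3 X * ox1 Y)%oct + (ox3 Y * ox1 X)%oct)))
     (2^-1 *: ((xi1 X + xi2 X) *: ox3 Y + (xi1 Y + xi2 Y) *: ox3 X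
         + oconj ((ox1 X * ox2 Y)%oct + (ox1 Y * ox2 X)%oct))).
rewrite -/(jordan_h1 X Y) in e1 e2 e3 f1 f2 f3.
have e0l x : (oe R 0 * x)%oct = x by case: (omul_oneP x).
have e0r x : (x * oe R 0)%oct = x by case: (omul_oneP x).
have V (u u' w : oct R) : u + u' = w -> u' = w - u by move=> <-; rewrite addrC addKr.
have d0 : forall (c c' a b : R) (u u' v v' e : oct R), c = c' -> u + u' = (2 * a) *: e ->
    v + v' = (2 * b) *: e ->
    2^-1 *: (c *: e + (- v - u) + (c' *: e + (- v' - u'))) = (c - a - b) *: e.
  move=> c c2 a b u u2 v v2 e <- hh hk; rewrite (V _ _ _ hh) (V _ _ _ hk); apply/rowP => k; rewrite !(octD, octN, octZ); by field.
have d1 : forall (c c' a b : R) (u u' v v' e : oct R), c = c' -> u + u' = (2 * a) *: e ->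
    v + v' = (2 * b) *: e ->
    2^-1 *: (- v + (c *: e + u) + (- v' + (c' *: e + u'))) = (c + a - b) *: e.
  move=> c c2 a b u u2 v v2 e <- hh hk; rewrite (V _ _ _ hh) (V _ _ _ hk); apply/rowP => k; rewrite !(octD, octN, octZ); by field.
have d2 : forall (c c' a b : R) (u u' v v' e : oct R), c = c' -> u + u' = (2 * a) *: e ->
    v + v' = (2 * b) *: e ->
    2^-1 *: (- v + (u + c *: e) + (- v' + (u' + c' *: e))) = (c + a - b) *: e.
  move=> c c2 a b u u2 v v2 e <- hh hk; rewrite (V _ _ _ hh) (V _ _ _ hk); apply/rowP => k; rewrite !(octD, octN, octZ); by field.
have key (u v w : oct R) : u = 2 *: w -> 2^-1 *: u = w.
  by move=> ->; rewrite scalerA mulVf ?scale1r // pnatr_eq0.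
apply/matrixP => i j; rewrite !mxE e1 e2 e3 f1 f2 f3 !big_ord_recl !big_ord0 !mxE.
case: i => [[|[|[|//]]] i3]; case: j => [[|[|[|//]]] j3] /=;
  rewrite !(ocplxM, ocplx_imM, oim_cplxM, oimagM, addr0);
  rewrite !(ocplx_add, oimag_add) ?half_ocplx ?half_oimag; congr (_ _).
9: rewrite !omulZl !omulZr e0l !scalerA.
9: apply: d2; [exact: mulrC|exact: oconj_suml|exact: oconj_sum].
5: rewrite !omulZl !omulZr e0l !scalerA.
5: apply: d1; [exact: mulrC|exact: oconj_sum|exact: oconj_suml].
1: rewrite !omulZl !omulZr e0l !scalerA.
1: apply: d0; [exact: mulrC|exact: oconj_suml|exact: oconj_sum].
all: rewrite ?(omulZl, omulZr, e0l, e0r) ?(oconjZ, oconjD, oconjN, oconj_mul, oconjK).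
all: by apply/rowP => k; rewrite !(octD, octN, octZ); field.
Qed.

Lemma h1_coordK (X : J1 R) : h1_coord (h1_mx X) = X.
Proof.
have re_e0 (t : R) : ore (t *: oe R 0) = t.
  by rewrite /ore octZ [X in _ * X]mxE eqxx mulr1.
rewrite /h1_coord !mxE /= !re_ocplx !im_oimag !re_e0.
set Y := h1 _ _ _ _ _ _; have := h1E (xi1 X) (xi2 X) (xi3 X) (ox1 X) (ox2 X) (ox3 X).
by case=> - [? ? ?] [? ? ?]; apply: J1P.
Qed.

Lemma jordanE (X Y : J1 R) : jordan X Y = jordan_h1 X Y.
Proof. by rewrite /jordan omx_jordanE h1_coordK. Qed.

Lemma h1_mx_jordan (X Y : J1 R) :
  h1_mx (jordan X Y) = omx_jordan (h1_mx X) (h1_mx Y).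
Proof. by rewrite jordanE omx_jordanE. Qed.

Lemma ipJE (X Y : J1 R) : ipJ X Y =
  xi1 X * xi1 Y + xi2 X * xi2 Y + xi3 X * xi3 Y
  + 2 * oip (ox1 X) (ox1 Y) - 2 * oip (ox2 X) (ox2 Y) - 2 * oip (ox3 X) (ox3 Y).
Proof.
rewrite /ipJ jordanE /trJ /jordan_h1.
set x1 := 2^-1 *: _; set x2 := 2^-1 *: _; set x3 := 2^-1 *: _.
have [[-> -> ->] _] := h1E (xi1 X * xi1 Y - oip (ox2 X) (ox2 Y) - oip (ox3 X) (ox3 Y))
     (xi2 X * xi2 Y + oip (ox1 X) (ox1 Y) - oip (ox3 X) (ox3 Y))
     (xi3 X * xi3 Y + oip (ox1 X) (ox1 Y) - oip (ox2 X) (ox2 Y)) x1 x2 x3.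
ring.
Qed.

Lemma lin_matE (f : J1 R -> J1 R) (X : J1 R) :
  (forall t Y Z, f (t *: Y + Z) = t *: f Y + f Z) -> lin_mat f *m X = f X.
Proof.
move=> lf; have f0 : f 0 = 0 by have := lf (-1) 0 0; rewrite !scaleN1r oppr0 addr0 addNr.
have fZ t Y : f (t *: Y) = t *: f Y by rewrite -[t *: Y]addr0 lf f0 addr0.
have fD Y Z : f (Y + Z) = f Y + f Z by rewrite -[Y in LHS]scale1r lf scale1r.
have {2}-> : X = \sum_j X j 0 *: delta_mx j 0.
  by rewrite [LHS]matrix_sum_delta; apply: eq_bigr => j _; rewrite big_ord1.
rewrite (big_morph f fD f0); apply/colP => i; rewrite !mxE summxE.
by apply: eq_bigr => j _; rewrite fZ !mxE mulrC.
Qed.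

Lemma coord_lin t (X Y : J1 R) : let Z := t *: X + Y in
  [/\ xi1 Z = t * xi1 X + xi1 Y, xi2 Z = t * xi2 X + xi2 Y
    & xi3 Z = t * xi3 X + xi3 Y] /\ [/\ ox1 Z = t *: ox1 X + ox1 Y, ox2 Z = t *: ox2 X + ox2 Y
    & ox3 Z = t *: ox3 X + ox3 Y].
Proof.
move=> Z; rewrite {}/Z.
by do 2 split; rewrite /xi1 /xi2 /xi3 ?mxE //; apply/rowP => k; rewrite !mxE.
Qed.

Lemma h1_lin t (a1 a2 a3 b1 b2 b3 : R) (x1 x2 x3 y1 y2 y3 : oct R) :
  h1 (t * a1 + b1) (t * a2 + b2) (t * a3 + b3)
     (t *: x1 + y1) (t *: x2 + y2) (t *: x3 + y3)
  = t *: h1 a1 a2 a3 x1 x2 x3 + h1 b1 b2 b3 y1 y2 y3.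
Proof.
have [[p1 p2 p3] [q1 q2 q3]] := h1E (t * a1 + b1) (t * a2 + b2) (t * a3 + b3)
     (t *: x1 + y1) (t *: x2 + y2) (t *: x3 + y3).
have [[r1 r2 r3] [s1 s2 s3]] := h1E a1 a2 a3 x1 x2 x3.
have [[u1 u2 u3] [v1 v2 v3]] := h1E b1 b2 b3 y1 y2 y3.
have [[c1 c2 c3] [d1 d2 d3]] := coord_lin t (h1 a1 a2 a3 x1 x2 x3) (h1 b1 b2 b3 y1 y2 y3).
apply: J1P; split.
- by rewrite p1 c1 r1 u1.
- by rewrite p2 c2 r2 u2.
- by rewrite p3 c3 r3 u3.
- by rewrite q1 d1 s1 v1.
- by rewrite q2 d2 s2 v2.
- by rewrite q3 d3 s3 v3.
Qed.

Lemma oip_lin t a x y : oip a (t *: x + y) = t * oip a x + oip a y.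
Proof.
rewrite !oip_sum mulr_sumr -big_split; apply: eq_bigr => i _; rewrite !mxE /=; ring.
Qed.

Lemma xi1L t (X Y : J1 R) : xi1 (t *: X + Y) = t * xi1 X + xi1 Y.
Proof. by case: (coord_lin t X Y) => [[? ? ?] [? ? ?]]. Qed.
Lemma xi2L t (X Y : J1 R) : xi2 (t *: X + Y) = t * xi2 X + xi2 Y.
Proof. by case: (coord_lin t X Y) => [[? ? ?] [? ? ?]]. Qed.
Lemma xi3L t (X Y : J1 R) : xi3 (t *: X + Y) = t * xi3 X + xi3 Y.
Proof. by case: (coord_lin t X Y) => [[? ? ?] [? ? ?]]. Qed.
Lemma ox1L t (X Y : J1 R) : ox1 (t *: X + Y) = t *: ox1 X + ox1 Y.
Proof. by case: (coord_lin t X Y) => [[? ? ?] [? ? ?]]. Qed.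
Lemma ox2L t (X Y : J1 R) : ox2 (t *: X + Y) = t *: ox2 X + ox2 Y.
Proof. by case: (coord_lin t X Y) => [[? ? ?] [? ? ?]]. Qed.
Lemma ox3L t (X Y : J1 R) : ox3 (t *: X + Y) = t *: ox3 X + ox3 Y.
Proof. by case: (coord_lin t X Y) => [[? ? ?] [? ? ?]]. Qed.

Ltac lin_tac := rewrite lin_matE // => t Y Z;
  rewrite /A1_fun /A2_fun /A3_fun /delta_fun -h1_lin;
  rewrite ?xi1L ?xi2L ?xi3L ?ox1L ?ox2L ?ox3L ?oip_lin ?(omulDl, omulDr, omulZl, omulZr);
  rewrite ?(oconjD, oconjZ); f_equal; try ring;
  apply/rowP => k; rewrite !(octD, octN, octZ, addr0) ?octZ; try ring.

Lemma A1E (a : oct R) (X : J1 R) : A1 a *m X = A1_fun a X. Proof. lin_tac. Qed.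
Lemma A2E (a : oct R) (X : J1 R) : A2 a *m X = A2_fun a X. Proof. lin_tac. Qed.
Lemma A3E (a : oct R) (X : J1 R) : A3 a *m X = A3_fun a X. Proof. lin_tac. Qed.
Lemma deltaJE (a : oct R) (X : J1 R) : deltaJ a *m X = delta_fun a X. Proof. lin_tac. Qed.

End JordanFacts.

(* Main.v *)
Require Import Defs.
From mathcomp Require Import all_boot all_order all_algebra.
From mathcomp Require Import all_classical all_reals all_analysis.
From mathcomp Require Import ring lra zify.
Import Order.TTheory GRing.Theory Num.Theory.
Import numFieldNormedType.Exports.
Local Open Scope classical_set_scope.
Local Open Scope ring_scope.

(** Since the trace of the left Jordan multiplication by X is 9 tr X, the form is invariant
    under F_4(-20), so that (gY|E_2) = (Y|X) for the idempotent X = g^-1 E_2.  The operator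
    A_3^1(1) is diagonalizable with eigenvalues 0, +-1, +-2, and G_1(x) + G_2(p) raises them;
    its exponential n fixes P^-, and when (X|P^-) <> 0 there is a unique n for which nX is
    orthogonal to all Q^+(u) and to all F_3^1(q) with q imaginary.  An idempotent of trace 1
    with these orthogonality relations has only the coordinates xi_1, xi_2 and Re x_3, and A
    moves it to E_2 or to E_1 according to the sign of (X|P^-).  The second case is excluded
    because the Peirce 1/2-space of E_1 is negative definite while that of E_2 is not.  For
    the density, translate g by a one-parameter subgroup of the unipotent group opposite to
    N^+: (gP^-|E_2) becomes a quartic polynomial, and if it vanished identically then X
    would have diagonal (1/3, 1/3, 1/3), which no idempotent of J^1 has. *)

Set Implicit Arguments.
Unset Strict Implicit.
Unset Printing Implicit Defensive.

Section OctonionCoordinates.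
Variable R : realType.
Implicit Types x y : oct R.

(** With octonions in this form, an octonion identity splits into eight polynomial identities for
    [ring] or [field]. *)
Definition oct8 (a0 a1 a2 a3 a4 a5 a6 a7 : R) : oct R :=
  \row_(k < 8) nth 0 [:: a0; a1; a2; a3; a4; a5; a6; a7] k.

Lemma oct8E a0 a1 a2 a3 a4 a5 a6 a7 j : (j < 8)%N ->
  oct8 a0 a1 a2 a3 a4 a5 a6 a7 0 (inord j) = nth 0 [:: a0; a1; a2; a3; a4; a5; a6; a7] j.
Proof. by move=> j8; rewrite mxE inordK. Qed.

Variant oct8_spec : oct R -> Type :=
  Oct8Spec a0 a1 a2 a3 a4 a5 a6 a7 : oct8_spec (oct8 a0 a1 a2 a3 a4 a5 a6 a7).

Lemma oct8P x : oct8_spec x.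
Proof.
suff -> : x = oct8 (x 0 (inord 0)) (x 0 (inord 1)) (x 0 (inord 2)) (x 0 (inord 3))
  (x 0 (inord 4)) (x 0 (inord 5)) (x 0 (inord 6)) (x 0 (inord 7)) by [].
by apply: oct_eqP => j j8; rewrite oct8E //; do 8 (case: j j8 => [//|j j8]).
Qed.

Variables (a0 a1 a2 a3 a4 a5 a6 a7 b0 b1 b2 b3 b4 b5 b6 b7 : R).
Let a := oct8 a0 a1 a2 a3 a4 a5 a6 a7.
Let b := oct8 b0 b1 b2 b3 b4 b5 b6 b7.

Lemma oct8D : a + b = oct8 (a0 + b0) (a1 + b1) (a2 + b2) (a3 + b3)
  (a4 + b4) (a5 + b5) (a6 + b6) (a7 + b7).
Proof. by apply/rowP => -[k k8]; rewrite !mxE /=; do 8 (case: k k8 => [//|k k8]). Qed.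

Lemma oct8N : - a = oct8 (- a0) (- a1) (- a2) (- a3) (- a4) (- a5) (- a6) (- a7).
Proof. by apply/rowP => -[k k8]; rewrite !mxE /=; do 8 (case: k k8 => [//|k k8]). Qed.

Lemma oct8Z t : t *: a = oct8 (t * a0) (t * a1) (t * a2) (t * a3)
  (t * a4) (t * a5) (t * a6) (t * a7).
Proof. by apply/rowP => -[k k8]; rewrite !mxE /=; do 8 (case: k k8 => [//|k k8]). Qed.

Lemma oct8_0 : 0 = oct8 0 0 0 0 0 0 0 0.
Proof. by apply/rowP => -[k k8]; rewrite !mxE /=; do 8 (case: k k8 => [//|k k8]). Qed.

Lemma oct8_1 : oe R 0 = oct8 1 0 0 0 0 0 0 0.
Proof. by apply/rowP => -[k k8]; rewrite !mxE -val_eqE /=; do 8 (case: k k8 => [//|k k8]). Qed.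

Lemma oct8_conj : oconj a = oct8 a0 (- a1) (- a2) (- a3) (- a4) (- a5) (- a6) (- a7).
Proof. by apply/rowP => -[k k8]; rewrite !mxE -val_eqE /=; do 8 (case: k k8 => [//|k k8]). Qed.

Lemma oct8_ip : oip a b =
  a0 * b0 + a1 * b1 + a2 * b2 + a3 * b3 + a4 * b4 + a5 * b5 + a6 * b6 + a7 * b7.
Proof. by rewrite oip_sum !big_ord_recl big_ord0 !mxE /=; ring. Qed.

Lemma oct8_re : ore a = a0. Proof. by rewrite /ore mxE. Qed.

Lemma oct8M : (a * b)%oct = oct8
  (a0 * b0 - a1 * b1 - a2 * b2 - a3 * b3 - a4 * b4 - a5 * b5 - a6 * b6 - a7 * b7)
  (a0 * b1 + a1 * b0 + (a2 * b4 - a4 * b2) + (a3 * b7 - a7 * b3) + (a5 * b6 - a6 * b5))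
  (a0 * b2 + a2 * b0 + (a3 * b5 - a5 * b3) + (a4 * b1 - a1 * b4) + (a6 * b7 - a7 * b6))
  (a0 * b3 + a3 * b0 + (a4 * b6 - a6 * b4) + (a5 * b2 - a2 * b5) + (a7 * b1 - a1 * b7))
  (a0 * b4 + a4 * b0 + (a5 * b7 - a7 * b5) + (a6 * b3 - a3 * b6) + (a1 * b2 - a2 * b1))
  (a0 * b5 + a5 * b0 + (a6 * b1 - a1 * b6) + (a7 * b4 - a4 * b7) + (a2 * b3 - a3 * b2))
  (a0 * b6 + a6 * b0 + (a7 * b2 - a2 * b7) + (a1 * b5 - a5 * b1) + (a3 * b4 - a4 * b3))
  (a0 * b7 + a7 * b0 + (a1 * b3 - a3 * b1) + (a2 * b6 - a6 * b2) + (a4 * b5 - a5 * b4)).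
Proof.
apply: oct_eqP => j j8; rewrite oct8E //.
by do 8 (case: j j8 => [_|j j8]; first by rewrite omulE // /a /b !oct8E).
Qed.

End OctonionCoordinates.

Ltac oct_simp :=
  rewrite ?oct8_1 ?oct8_0; repeat (progress rewrite ?(oct8Z, oct8N, oct8_conj, oct8M, oct8D));
  rewrite ?(oct8_ip, oct8_re).

Ltac oct_destruct :=
  match goal with
  | x : oct _ |- _ => case: (oct8P x) => {x} ? ? ? ? ? ? ? ?
  end.

(** * Elements of J^1 as sextuples of coordinates *)

Section JordanCoordinates.
Variable R : realType.
Implicit Types (x y p q : oct R) (X Y Z : J1 R) (g D : endJ R).

Lemma omul0l x : omul 0 x = 0.
Proof. by have := omulZl 0 0 x; rewrite !scale0r. Qed.

Lemma omul0r x : omul x 0 = 0.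
Proof. by have := omulZr 0 x 0; rewrite !scale0r. Qed.

Lemma oconj0 : oconj 0 = 0 :> oct R.
Proof. by have := oconjZ 0 (0 : oct R); rewrite !scale0r. Qed.

Lemma h1_eta X : X = h1 (xi1 X) (xi2 X) (xi3 X) (ox1 X) (ox2 X) (ox3 X).
Proof.
by have := h1E (xi1 X) (xi2 X) (xi3 X) (ox1 X) (ox2 X) (ox3 X); case=> -[? ? ?] [? ? ?];
  apply: J1P.
Qed.

Variant h1_spec : J1 R -> Type := H1Spec a b c x y z : h1_spec (h1 a b c x y z).

Lemma h1P X : h1_spec X. Proof. by rewrite [X]h1_eta. Qed.

Lemma xi1_h1 a b c x y z : xi1 (@h1 R a b c x y z) = a.
Proof. by case: (h1E a b c x y z) => -[? ? ?] []. Qed.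
Lemma xi2_h1 a b c x y z : xi2 (@h1 R a b c x y z) = b.
Proof. by case: (h1E a b c x y z) => -[? ? ?] []. Qed.
Lemma xi3_h1 a b c x y z : xi3 (@h1 R a b c x y z) = c.
Proof. by case: (h1E a b c x y z) => -[? ? ?] []. Qed.
Lemma ox1_h1 a b c x y z : ox1 (@h1 R a b c x y z) = x.
Proof. by case: (h1E a b c x y z) => _ []. Qed.
Lemma ox2_h1 a b c x y z : ox2 (@h1 R a b c x y z) = y.
Proof. by case: (h1E a b c x y z) => _ []. Qed.
Lemma ox3_h1 a b c x y z : ox3 (@h1 R a b c x y z) = z.
Proof. by case: (h1E a b c x y z) => _ []. Qed.
Definition h1_coords := (xi1_h1, xi2_h1, xi3_h1, ox1_h1, ox2_h1, ox3_h1).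

Lemma h1D a b c x y z a' b' c' x' y' z' :
  @h1 R a b c x y z + h1 a' b' c' x' y' z' =
  h1 (a + a') (b + b') (c + c') (x + x') (y + y') (z + z').
Proof. by rewrite -[h1 a b c x y z]scale1r -h1_lin !mul1r !scale1r. Qed.

Lemma h10 : @h1 R 0 0 0 0 0 0 = 0.
Proof.
have := h1_lin (-1) (0 : R) 0 0 0 0 0 (0 : oct R) 0 0 0 0 0.
by rewrite !mulr0 !scaler0 !addr0 => ->; rewrite scaleN1r addNr.
Qed.

Lemma h1Z t a b c x y z :
  t *: @h1 R a b c x y z = h1 (t * a) (t * b) (t * c) (t *: x) (t *: y) (t *: z).
Proof. by rewrite -[LHS]addr0 -h10 -h1_lin !addr0. Qed.

Lemma h1N a b c x y z :
  - @h1 R a b c x y z = h1 (- a) (- b) (- c) (- x) (- y) (- z).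
Proof. by rewrite -scaleN1r h1Z !mulN1r !scaleN1r. Qed.

Lemma eq_h1 a b c x y z a' b' c' x' y' z' :
  a = a' -> b = b' -> c = c' -> x = x' -> y = y' -> z = z' ->
  @h1 R a b c x y z = h1 a' b' c' x' y' z'.
Proof. by do 6 move=> ->. Qed.

End JordanCoordinates.

Ltac h1_field := apply: eq_h1;
  [oct_simp; field|oct_simp; field|oct_simp; field|oct_simp; congr oct8; field..].

(** * Bilinearity of the Jordan product and the Leibniz rule on squares *)

Section JordanAlgebra.
Variable R : realType.
Implicit Types (x y p q : oct R) (X Y Z : J1 R) (g D : endJ R) (t : R).

(** Expanding the hypothesis at u + v and cancelling the pure squares leaves twice the claim. *)
Lemma polarize (K : realFieldType) (V : lmodType K) (D : V -> V) (J : V -> V -> V) :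
  {morph D : u v / u + v} -> (forall u v w, J (u + v) w = J u w + J v w) ->
  (forall u v, J u v = J v u) -> (forall u, D (J u u) = 2 *: J (D u) u) ->
  forall u v, D (J u v) = J (D u) v + J u (D v).
Proof.
move=> DD Jl JC DS u v.
have Jr a b c : J a (b + c) = J a b + J a c by rewrite !(JC a) Jl.
have two (w w' : V) : 2 *: w = 2 *: w' -> w = w'.
  by move=> /(congr1 (fun w => 2^-1 *: w)); rewrite !scalerA mulVf ?pnatr_eq0 // !scale1r.
apply: two; have := DS (u + v).
rewrite !(DD, Jl, Jr) !DS (JC v u) (JC u (D v)) !scalerDr -!addrA => /addrI.
rewrite !addrA => /addIr; rewrite [RHS]addrC => <-; exact: scaler_nat.
Qed.

Definition derivation (D : endJ R) :=
  forall X Y, D *m jordan X Y = jordan (D *m X) Y + jordan X (D *m Y).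

Lemma jordan_h1E a b c x y z a' b' c' x' y' z' :
  jordan (@h1 R a b c x y z) (h1 a' b' c' x' y' z') =
  h1 (a * a' - oip y y' - oip z z') (b * b' + oip x x' - oip z z')
     (c * c' + oip x x' - oip y y')
     (2^-1 *: ((b + c) *: x' + (b' + c') *: x - oconj ((y * z')%oct + (y' * z)%oct)))
     (2^-1 *: ((a + c) *: y' + (a' + c') *: y + oconj ((z * x')%oct + (z' * x)%oct)))
     (2^-1 *: ((a + b) *: z' + (a' + b') *: z + oconj ((x * y')%oct + (x' * y)%oct))).
Proof. by rewrite jordanE /jordan_h1 !h1_coords. Qed.

Lemma jordan_sq a b c x y z : let X := @h1 R a b c x y z in
  jordan X X = h1 (a * a - oip y y - oip z z) (b * b + oip x x - oip z z)
     (c * c + oip x x - oip y y)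
     ((b + c) *: x - oconj (y * z)%oct) ((a + c) *: y + oconj (z * x)%oct)
     ((a + b) *: z + oconj (x * y)%oct).
Proof.
have half (u v : oct R) : u = 2 *: v -> 2^-1 *: u = v.
  by move=> ->; rewrite scalerA mulVf ?scale1r ?pnatr_eq0.
rewrite /= jordan_h1E; apply: eq_h1; [by []|by []|by []| | |].
all: by apply: half; apply/rowP => i; rewrite !(oconjD, octD, octN, octZ); ring.
Qed.

Lemma oipC (x y : oct R) : oip x y = oip y x.
Proof. by rewrite !oip_sum; apply: eq_bigr => i _; rewrite mulrC. Qed.

Lemma oipDl (x y z : oct R) : oip (x + y) z = oip x z + oip y z.
Proof. by rewrite !oip_sum -big_split; apply: eq_bigr => i _; rewrite !mxE mulrDl. Qed.

Lemma oipZl t (x y : oct R) : oip (t *: x) y = t * oip x y.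
Proof. by rewrite !oip_sum mulr_sumr; apply: eq_bigr => i _; rewrite !mxE mulrA. Qed.

Lemma jordanC X Y : jordan X Y = jordan Y X.
Proof.
case: (h1P X) => a b c x y z; case: (h1P Y) => a' b' c' x' y' z'.
rewrite !jordan_h1E; apply: eq_h1.
- by rewrite mulrC (oipC y) (oipC z).
- by rewrite mulrC (oipC x) (oipC z).
- by rewrite mulrC (oipC x) (oipC y).
- by rewrite [omul y' z + _]addrC [_ *: x + _]addrC.
- by rewrite [omul z' x + _]addrC [_ *: y + _]addrC.
- by rewrite [omul x' y + _]addrC [_ *: z + _]addrC.
Qed.

Lemma jordanDl X X' Y : jordan (X + X') Y = jordan X Y + jordan X' Y.
Proof.
case: (h1P X) => a b c x y z; case: (h1P X') => a' b' c' x' y' z'.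
case: (h1P Y) => a2 b2 c2 x2 y2 z2.
have aux (r s t r' s' t' : R) (u u' v w w' k k' : oct R) :
    (r + r' + (s + s')) *: v + t *: (u + u') + (w + w' + (k + k')) =
    (r + s) *: v + t *: u + (w + k) + ((r' + s') *: v + t *: u' + (w' + k')).
  by apply/rowP => i; rewrite !(octD, octN, octZ); ring.
rewrite !(h1D, jordan_h1E); apply: eq_h1; rewrite ?oipDl.
- ring.
- ring.
- ring.
- by rewrite !omulDl !omulDr -scalerDr !oconjD !opprD aux.
- by rewrite !omulDl !omulDr -scalerDr !oconjD aux.
- by rewrite !omulDl !omulDr -scalerDr !oconjD aux.
Qed.

Lemma jordanZl t X Y : jordan (t *: X) Y = t *: jordan X Y.
Proof.
case: (h1P X) => a b c x y z; case: (h1P Y) => a' b' c' x' y' z'.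
have aux (r s k : R) (u v w w' : oct R) :
    2^-1 *: ((t * r + t * s) *: v + k *: (t *: u) + (t *: w + t *: w')) =
    t *: (2^-1 *: ((r + s) *: v + k *: u + (w + w'))).
  by apply/rowP => i; rewrite !(octD, octN, octZ); ring.
rewrite !(h1Z, jordan_h1E); apply: eq_h1; rewrite ?oipZl.
- ring.
- ring.
- ring.
- by rewrite !omulZl !omulZr !oconjD !oconjZ !opprD -!scalerN aux.
- by rewrite !omulZl !omulZr !oconjD !oconjZ aux.
- by rewrite !omulZl !omulZr !oconjD !oconjZ aux.
Qed.

Lemma jordanDr X Y Y' : jordan X (Y + Y') = jordan X Y + jordan X Y'.
Proof. by rewrite ![jordan X _]jordanC jordanDl. Qed.

Lemma jordanZr t X Y : jordan X (t *: Y) = t *: jordan X Y.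
Proof. by rewrite ![jordan X _]jordanC jordanZl. Qed.

(** Polarization lets the coordinate checks involve one element of J^1 instead of two. *)
Lemma derivation_sq D :
  (forall X, D *m jordan X X = 2 *: jordan (D *m X) X) -> derivation D.
Proof.
move=> DS X Y.
refine (@polarize R (J1 R) (mulmx D) (@jordan R) _ _ _ _ X Y).
- exact: mulmxDr.
- exact: jordanDl.
- exact: jordanC.
- exact: DS.
Qed.

Lemma A1_h1 (u : oct R) a b c x y z : A1 u *m h1 a b c x y z =
  h1 0 (2 * oip u x) (- (2 * oip u x)) (- ((b - c) *: u))
     (- oconj (z * u)%oct) (oconj (u * y)%oct).
Proof. by rewrite A1E /A1_fun !h1_coords. Qed.

Lemma A2_h1 (u : oct R) a b c x y z : A2 u *m h1 a b c x y z =
  h1 (2 * oip u y) 0 (- (2 * oip u y)) (- oconj (u * z)%oct) (- ((c - a) *: u))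
     (- oconj (x * u)%oct).
Proof. by rewrite A2E /A2_fun !h1_coords. Qed.

Lemma A3_h1 (u : oct R) a b c x y z : A3 u *m h1 a b c x y z =
  h1 (- (2 * oip u z)) (2 * oip u z) 0 (oconj (y * u)%oct) (oconj (u * x)%oct)
     (- ((a - b) *: u)).
Proof. by rewrite A3E /A3_fun !h1_coords. Qed.

Lemma deltaJ_h1 (p : oct R) a b c x y z : deltaJ p *m h1 a b c x y z =
  h1 0 0 0 (p * x)%oct (y * p)%oct (- ((p * z)%oct + (z * p)%oct)).
Proof. by rewrite deltaJE /delta_fun !h1_coords. Qed.

End JordanAlgebra.

(** * The operators A_i^1(a), delta(p), G_1(x) and G_2(p) as derivations *)

Section Derivations.
Variable R : realType.
Implicit Types (x y p q : oct R) (X Y Z : J1 R) (g D : endJ R) (t : R).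

Lemma A1_derivation (u : oct R) : derivation (A1 u).
Proof.
apply: derivation_sq => X; case: (h1P X) => a b c x y z.
rewrite jordan_sq !A1_h1 jordan_h1E h1Z; do 4 oct_destruct.
by h1_field.
Qed.

Lemma A2_derivation (u : oct R) : derivation (A2 u).
Proof.
apply: derivation_sq => X; case: (h1P X) => a b c x y z.
rewrite jordan_sq !A2_h1 jordan_h1E h1Z; do 4 oct_destruct.
by h1_field.
Qed.

Lemma A3_derivation (u : oct R) : derivation (A3 u).
Proof.
apply: derivation_sq => X; case: (h1P X) => a b c x y z.
rewrite jordan_sq !A3_h1 jordan_h1E h1Z; do 4 oct_destruct.
by h1_field.
Qed.

Lemma deltaJ_derivation (p : oct R) : oIm p -> derivation (deltaJ p).
Proof.
move=> p0; apply: derivation_sq => X; case: (h1P X) => a b c x y z.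
rewrite jordan_sq !deltaJ_h1 jordan_h1E h1Z; move: p0; rewrite /oIm; do 4 oct_destruct.
rewrite oct8_re => ->.
by h1_field.
Qed.

Lemma derivationD D D' : derivation D -> derivation D' -> derivation (D + D').
Proof.
move=> d d' X Y; rewrite (mulmxDl D D' (jordan X Y)) (mulmxDl D D' X) (mulmxDl D D' Y).
by rewrite (jordanDl (D *m X)) (jordanDr X (D *m Y)) d d'; exact: addrACA.
Qed.

Lemma derivationZ t D : derivation D -> derivation (t *: D).
Proof.
move=> d X Y; rewrite -(scalemxAl t D (jordan X Y)) -(scalemxAl t D X) -(scalemxAl t D Y).
by rewrite jordanZl jordanZr d; exact: scalerDr.
Qed.

Lemma G1_derivation x : derivation (G1 x).
Proof. by apply: derivationD; [exact: A1_derivation|exact: A2_derivation]. Qed.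

Lemma G2_derivation p : oIm p -> derivation (G2 p).
Proof.
move=> p0; apply: derivationD; first exact: A3_derivation.
by rewrite -scaleN1r; apply: derivationZ; exact: deltaJ_derivation.
Qed.

End Derivations.

(** * Trace of the left Jordan multiplications *)

Section LeftMultiplicationTrace.
Variable R : realType.
Implicit Types (x y p q : oct R) (X Y Z : J1 R) (g D : endJ R) (t : R).

Lemma eq_endJ D D' : (forall X, D *m X = D' *m X) -> D = D'.
Proof.
move=> e; apply/matrixP => i j; have := congr1 (fun Z : J1 R => Z i 0) (e (delta_mx j 0)).
by rewrite /= -!colE !mxE.
Qed.

Definition Ljordan X : endJ R := lin_mat (jordan X).

Lemma LjordanE X Y : Ljordan X *m Y = jordan X Y.
Proof. by apply: lin_matE => t Y' Z; rewrite jordanDr jordanZr. Qed.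

Let F (n : nat) : J1 R := delta_mx (inord n) 0.

Let FE n m : (n < 27)%N -> (m < 27)%N -> F n (inord m) 0 = (m == n)%:R.
Proof. by move=> ? ?; rewrite mxE -val_eqE /= !inordK // andbT. Qed.

Let FP n : (n < 27)%N -> F n =
  h1 (0 == n)%:R (1 == n)%:R (2 == n)%:R (\row_k (3 + k == n)%N%:R)
     (\row_k (11 + k == n)%N%:R) (\row_k (19 + k == n)%N%:R).
Proof.
have b27 m (k : 'I_8) : (m <= 19)%N -> (m + k < 27)%N.
  by move=> m19; apply: leq_ltn_trans (leq_add m19 (leqnn k)) _; rewrite (ltn_add2l 19 k 8).
move=> n27; apply: J1P; rewrite !h1_coords /xi1 /xi2 /xi3 ?FE //.
by split; apply/rowP => k; rewrite [LHS]mxE [RHS]mxE FE // b27.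
Qed.

Let F_oe k : (k < 8)%N ->
  [/\ F (3 + k) = h1 0 0 0 (oe R (inord k)) 0 0,
      F (11 + k) = h1 0 0 0 0 (oe R (inord k)) 0 &
      F (19 + k) = h1 0 0 0 0 0 (oe R (inord k))].
Proof.
move=> k8; have b27 m : (m <= 19)%N -> (m + k < 27)%N.
  by move=> m19; apply: leq_ltn_trans (leq_add m19 (leqnn k)) _; rewrite (ltn_add2l 19 k 8).
have delta_row m (f : 'I_8 -> bool) : (forall j : 'I_8, f j = (m + j == m + k)%N) ->
    \row_j (f j)%:R = oe R (inord k).
  move=> fE; apply/rowP => j; by rewrite !mxE eqxx fE eqn_add2l -(inj_eq val_inj) /= inordK.
have zero_row (f : 'I_8 -> bool) : (forall j : 'I_8, f j = false) -> \row_j (f j)%:R = 0 :> oct R.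
  by move=> f0; apply/rowP => j; rewrite !mxE f0.
split; rewrite FP ?b27 //; (apply: eq_h1; [by []|by []|by []|..]).
- by apply: (@delta_row 3).
- by apply: zero_row => j; have := ltn_ord j; clear -k8; lia.
- by apply: zero_row => j; have := ltn_ord j; clear -k8; lia.
- by apply: zero_row => j; have := ltn_ord j; clear -k8; lia.
- by apply: (@delta_row 11).
- by apply: zero_row => j; have := ltn_ord j; clear -k8; lia.
- by apply: zero_row => j; have := ltn_ord j; clear -k8; lia.
- by apply: zero_row => j; have := ltn_ord j; clear -k8; lia.
- by apply: (@delta_row 19).
Qed.

(** The diagonal entry is xi_i at E_i, and half the sum of two of the xi_i at each of the 24
    octonion basis vectors; the total is tr X + 8 tr X. *)
Lemma tr_Ljordan X : \tr (Ljordan X) = 9 * trJ X.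
Proof.
have -> : \tr (Ljordan X) = \sum_(0 <= n < 27) jordan X (F n) (inord n) 0.
  rewrite big_mkord; apply: eq_bigr => i _.
  by rewrite -LjordanE /F inord_val -colE [RHS]mxE.
(* The blocks x_1, x_2 and x_3 of [h1] begin at positions 3, 11 and 19. *)
rewrite (@big_cat_nat _ _ _ 3) //= (@big_cat_nat _ _ _ 11 3) //= (@big_cat_nat _ _ _ 19 11) //=.
have shift m n (G : nat -> R) : \sum_(m <= i < m + n) G i = \sum_(k < n) G (m + k)%N.
  by rewrite -{1}[m]add0n big_addn addKn big_mkord; apply: eq_bigr => k _; rewrite addnC.
rewrite (shift 3%N 8%N) (shift 11%N 8%N) (shift 19%N 8%N).
case: (h1P X) => a b c x y z.
have oe_diag k : oe R k 0 k = 1 by rewrite mxE !eqxx.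
have h1_entry (k : 'I_8) : [/\ forall Y, Y (inord (3 + k)) 0 = ox1 Y 0 k,
    forall Y, Y (inord (11 + k)) 0 = ox2 Y 0 k & forall Y, Y (inord (19 + k)) 0 = ox3 Y 0 k].
  by split=> Y; rewrite mxE.
have simp := (omul0l, omul0r, addr0, oconj0, subr0, scaler0, scale0r, oe_diag, mulr1).
have sum8 r (G : nat -> R) : (forall k : 'I_8, G k = r) -> \sum_(k < 8) G k = r *+ 8.
  by move=> Gr; rewrite (eq_bigr (fun=> r)) // sumr_const card_ord.
have key (s0 s1 s2 s3 : R) : s0 = a + b + c -> s1 = (2^-1 * (b + c)) *+ 8 ->
    s2 = (2^-1 * (a + c)) *+ 8 -> s3 = (2^-1 * (a + b)) *+ 8 ->
    s0 + (s1 + (s2 + s3)) = 9 * trJ (h1 a b c x y z).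
  by move=> -> -> -> ->; rewrite /trJ !h1_coords; field.
apply: key.
- have F0 n : (n < 3)%N -> F n = h1 (0 == n)%N%:R (1 == n)%N%:R (2 == n)%N%:R 0 0 0.
    move=> n3; rewrite FP ?(leq_trans n3) //; apply: eq_h1; [by []|by []|by []|..].
    + by apply/rowP => j; rewrite !mxE; case: eqP => //; clear -n3; lia.
    + by apply/rowP => j; rewrite !mxE; case: eqP => //; clear -n3; lia.
    + by apply/rowP => j; rewrite !mxE; case: eqP => //; clear -n3; lia.
  have oip0 (u : oct R) : oip u 0 = 0 by rewrite oipC -(scale0r u) oipZl mul0r.
  rewrite big_mkord !big_ord_recl big_ord0 /bump /= !F0 // !jordan_h1E.
  rewrite -[h1 _ _ _ _ _ _ (inord 0) 0]/(xi1 _) -[h1 _ _ _ _ _ _ (inord (1 + 0)) 0]/(xi2 _).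
  by rewrite -[h1 _ _ _ _ _ _ (inord _) 0]/(xi3 _) !h1_coords !oip0 /=; ring.
- apply: (sum8 _ (fun k => jordan _ (F (3 + k)) (inord (3 + k)) 0)) => k.
  have [F1 _ _] := F_oe (ltn_ord k); have [e1 _ _] := h1_entry k.
  by rewrite e1 F1 inord_val jordan_h1E h1_coords !simp !octZ !simp.
- apply: (sum8 _ (fun k => jordan _ (F (11 + k)) (inord (11 + k)) 0)) => k.
  have [_ F2 _] := F_oe (ltn_ord k); have [_ e2 _] := h1_entry k.
  by rewrite e2 F2 inord_val jordan_h1E h1_coords !simp !octZ !simp.
- apply: (sum8 _ (fun k => jordan _ (F (19 + k)) (inord (19 + k)) 0)) => k.
  have [_ _ F3] := F_oe (ltn_ord k); have [_ _ e3] := h1_entry k.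
  by rewrite e3 F3 inord_val jordan_h1E h1_coords !simp !octZ !simp.
Qed.

End LeftMultiplicationTrace.

(** * Invariance of the trace and of the form; group laws *)

Section InvariantForm.
Variable R : realType.
Implicit Types (x y p q : oct R) (X Y Z : J1 R) (g D : endJ R) (t : R).

(** An automorphism conjugates left multiplications, L(gX) = g L(X) g^-1, and conjugate matrices
    have equal traces. *)
Lemma trJ_F4 g X : F4 g -> trJ (g *m X) = trJ X.
Proof.
move=> [gU gJ]; have nine : (9 : R) != 0 by rewrite pnatr_eq0.
apply: (mulfI nine); rewrite -!tr_Ljordan.
have -> : Ljordan (g *m X) = g *m Ljordan X *m invmx g.
  apply: eq_endJ => Y; rewrite LjordanE -(mulmxA (g *m _)) -(mulmxA g) LjordanE gJ.
  by rewrite mulKVmx.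
by rewrite mxtrace_mulC mulmxA mulVmx // mul1mx.
Qed.

Lemma ipJ_F4 g X Y : F4 g -> ipJ (g *m X) (g *m Y) = ipJ X Y.
Proof. by move=> Fg; rewrite /ipJ -(proj2 Fg X Y) trJ_F4. Qed.

Lemma F4_mul g g' : F4 g -> F4 g' -> F4 (g *m g').
Proof.
move=> [gU gJ] [gU' gJ']; split; first by rewrite unitmx_mul gU.
move=> X Y; rewrite -(mulmxA g g' (jordan X Y)) -(mulmxA g g' X) -(mulmxA g g' Y).
by rewrite gJ' gJ.
Qed.

Lemma F4_inv g : F4 g -> F4 (invmx g).
Proof.
move=> [gU gJ]; split; first by rewrite unitmx_inv.
move=> X Y; have := gJ (invmx g *m X) (invmx g *m Y).
by rewrite (mulKVmx gU X) (mulKVmx gU Y) => <-; rewrite mulKmx.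
Qed.

End InvariantForm.

(** * Entrywise convergence and exponentials of nilpotent derivations *)

Section NilpotentExponential.
Variable R : realType.
Implicit Types (x y p q : oct R) (X Y Z : J1 R) (g D : endJ R) (t : R).

(** A neighbourhood of a matrix contains a product of neighbourhoods of its finitely many entries,
    so the conditions on the entries can be intersected in F. *)
Lemma cvg_mx_entries (T : topologicalType) m n (F : set_system 'M[T]_(m, n))
    (M : 'M[T]_(m, n)) : Filter F ->
  (forall i j, (fun A : 'M[T]_(m, n) => A i j) @ F --> M i j) -> F --> M.
Proof.
move=> FF h A [P MP sPA]; have : F [set B : 'M[T]_(m, n) | forall i j, P i j (B i j)].
  apply: (@filter_forall _ _ (fun i (B : 'M[T]_(m, n)) => forall j, P i j (B i j))) => i.
  by apply: (@filter_forall _ _ (fun j (B : 'M[T]_(m, n)) => P i j (B i j))) => j; apply: h.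
by apply: filterS => B; exact: sPA.
Qed.

Lemma cvg_entry m n (F : set_system 'M[R]_(m, n)) (M : 'M[R]_(m, n)) i j : Filter F ->
  F --> M -> (fun A : 'M[R]_(m, n) => A i j) @ F --> M i j.
Proof.
(* This neighbourhood of M constrains only the entry (i, j). *)
move=> FF FM A MA; apply: FM; exists (fun i' j' => if (i' == i) && (j' == j) then A else setT).
  by move=> i' j'; case: andP => [[/eqP -> /eqP ->]//|_]; exact: filterT.
by move=> B /(_ i j); rewrite !eqxx.
Qed.

Lemma cvg_sumr (T I : Type) (F : set_system T) (r : seq I) (f : I -> T -> R) (l : I -> R) :
  Filter F -> (forall i, f i @ F --> l i) ->
  (fun u => \sum_(i <- r) f i u) @ F --> \sum_(i <- r) l i.
Proof.
move=> FF fl; elim: r => [|i r IH].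
  rewrite big_nil (_ : (fun _ => _) = fun=> 0); first exact: cvg_cst.
  by apply/funext => u; rewrite big_nil.
rewrite big_cons (_ : (fun _ => _) = f i \+ fun u => \sum_(j <- r) f j u).
  by apply: cvgD => //; exact: fl.
by apply/funext => u; rewrite big_cons.
Qed.

Lemma cvg_mulmx m n k (F : set_system 'M[R]_(m, n)) (M : 'M[R]_(m, n)) (B : 'M[R]_(n, k)) :
  Filter F -> F --> M -> (fun A : 'M[R]_(m, n) => A *m B) @ F --> M *m B.
Proof.
move=> FF FM; apply: cvg_mx_entries => i j.
change ((fun A : 'M[R]_(m, n) => (A *m B) i j) @ F --> (M *m B) i j).
rewrite mxE (_ : (fun _ => _) = fun A : 'M[R]_(m, n) => \sum_l A i l * B l j).
  by apply: cvg_sumr => l; apply: cvgMl; exact: cvg_entry.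
by apply/funext => A; rewrite mxE.
Qed.

(** The partial sums are constant from index m on. *)
Lemma expJ_nilpotent D m : D ^+ m = 0 -> expJ D = \sum_(k < m) (k`!%:R)^-1 *: D ^+ k.
Proof.
move=> Dm; apply/cvg_lim => //; apply: cvg_near_cst.
exists m => // n /= mn; rewrite /series /= (@big_cat_nat _ _ _ m) //= big_mkord.
rewrite [X in _ + X]big_nat_cond [X in _ + X]big1 ?addr0 // => i /andP[/andP[mi _] _].
by rewrite -(subnK mi) exprD Dm mulr0 scaler0.
Qed.

Lemma exprSm D n X : D ^+ n.+1 *m X = D *m (D ^+ n *m X).
Proof. by rewrite exprS mulmxA. Qed.

Lemma expr_eigen D t Z n : D *m Z = t *: Z -> D ^+ n *m Z = t ^+ n *: Z.
Proof.
move=> DZ; elim: n => [|n IH]; first by rewrite expr0 scale1r mul1mx.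
by rewrite exprSm IH -scalemxAr DZ scalerA exprSr.
Qed.

Lemma cvg_expJ_eigen D t Z : D *m Z = t *: Z ->
  (fun n => series (fun n => (n`!%:R)^-1 *: D ^+ n) n *m Z) @ \oo --> expR t *: Z.
Proof.
move=> DZ; rewrite (_ : (fun _ => _) = fun n => series (exp_coeff t) n *: Z).
  by apply: cvgZl; exact: is_cvg_series_exp_coeff.
apply/funext => n; rewrite /series /= mulmx_suml scaler_suml; apply: eq_bigr => i _.
by rewrite -scalemxAl (expr_eigen _ DZ) scalerA /exp_coeff /= mulrC.
Qed.

(** Leibniz formula for the divided powers d^k / k!, for abstract sequences with d a_n = (n+1)
    a_(n+1). The induction compares both sides after multiplication by k + 1. *)
Lemma leibniz_divided (V : lmodType R) (J : V -> V -> V) (d : V -> V) (a b c : nat -> V) :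
  {morph d : u v / u + v} ->
  (forall u u' v, J (u + u') v = J u v + J u' v) ->
  (forall u v v', J u (v + v') = J u v + J u v') ->
  (forall r u v, J (r *: u) v = r *: J u v) ->
  (forall r u v, J u (r *: v) = r *: J u v) ->
  (forall u v, d (J u v) = J (d u) v + J u (d v)) ->
  (forall n, d (a n) = n.+1%:R *: a n.+1) ->
  (forall n, d (b n) = n.+1%:R *: b n.+1) ->
  (forall n, d (c n) = n.+1%:R *: c n.+1) ->
  c 0%N = J (a 0%N) (b 0%N) ->
  forall k, c k = \sum_(i < k.+1) J (a i) (b (k - i)%N).
Proof.
move=> dD JDl JDr JZl JZr dJ da db dc c0; elim=> [|k IH].
  by rewrite big_ord_recl big_ord0 addr0.
have d0 : d 0 = 0 by apply: (@addIr _ (d 0)); rewrite -dD !add0r.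
have k0 : k.+1%:R != 0 :> R by rewrite pnatr_eq0.
apply: (scalerI k0); rewrite -dc IH (big_morph d dD d0) scaler_sumr.
(* The weight k + 1 = i + (k + 1 - i) is split; the two parts match d acting on the left and on the
   right factor. *)
have -> : \sum_(i < k.+2) k.+1%:R *: J (a i) (b (k.+1 - i)%N) =
   \sum_(i < k.+2) i%:R *: J (a i) (b (k.+1 - i)%N) +
   \sum_(i < k.+2) (k.+1 - i)%N%:R *: J (a i) (b (k.+1 - i)%N).
  rewrite -big_split; apply: eq_bigr => i _ /=.
  by rewrite -scalerDl -natrD subnKC // -ltnS ltn_ord.
rewrite [X in _ = X + _]big_ord_recl scale0r add0r.
rewrite [X in _ = _ + X]big_ord_recr /= subnn scale0r addr0.
rewrite -big_split; apply: eq_bigr => i _ /=.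
rewrite dJ da db JZl JZr subSS /bump /= add1n; congr (_ + _).
by rewrite subSn // -ltnS ltn_ord.
Qed.

(** Both sides run over the pairs with i + j < n, by antidiagonals and by rows. *)
Lemma triangular_sum (V : nmodType) (G : nat -> nat -> V) n :
  \sum_(k < n) \sum_(i < k.+1) G i (k - i)%N = \sum_(i < n) \sum_(j < n - i) G i j.
Proof.
elim: n => [|n IH]; first by rewrite !big_ord0.
rewrite big_ord_recr IH [RHS]big_ord_recr /= subSnn big_ord1.
rewrite [X in _ + X = _]big_ord_recr /= subnn addrA; congr (_ + _).
rewrite -big_split; apply: eq_bigr => i _ /=.
by rewrite subSn ?big_ord_recr // ltnW // ltn_ord.
Qed.

(** The antidiagonals i + j < 2m cover the square i, j < m, and the terms outside it vanish. *)
Lemma cauchy_product (V : nmodType) (G : nat -> nat -> V) m :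
  (forall i j, (m <= i)%N -> G i j = 0) -> (forall i j, (m <= j)%N -> G i j = 0) ->
  \sum_(k < m + m) \sum_(i < k.+1) G i (k - i)%N = \sum_(i < m) \sum_(j < m) G i j.
Proof.
move=> G1 G2; rewrite triangular_sum big_split_ord /= [X in _ + X]big1 ?addr0; last first.
  by move=> i _; apply: big1 => j _; apply: G1; rewrite leq_addr.
apply: eq_bigr => i _; rewrite -addnBA; last by rewrite ltnW // ltn_ord.
rewrite big_split_ord /= [X in _ + X]big1 ?addr0 // => j _.
by apply: G2; rewrite leq_addr.
Qed.

(** exp D is invertible as 1 minus a nilpotent matrix. It is multiplicative because the Leibniz
    formula for D^k / k! turns it into a Cauchy product. *)
Lemma expJ_nilpotent_F4 D m : derivation D -> D ^+ m = 0 -> F4 (expJ D).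
Proof.
move=> dD Dm; have exp_poly n : (m <= n)%N -> expJ D = \sum_(k < n) (k`!%:R)^-1 *: D ^+ k.
  by move=> mn; apply: expJ_nilpotent; rewrite -(subnK mn) exprD Dm mulr0.
pose a Z n : J1 R := (n`!%:R)^-1 *: (D ^+ n *m Z).
have exp_a n Z : (m <= n)%N -> expJ D *m Z = \sum_(k < n) a Z k.
  by move=> mn; rewrite (exp_poly n mn) mulmx_suml; apply: eq_bigr => k _; rewrite -scalemxAl.
have a0 Z n : (m <= n)%N -> a Z n = 0.
  by move=> mn; rewrite /a -(subnK mn) exprD Dm mulr0 mul0mx scaler0.
have Da Z n : D *m a Z n = n.+1%:R *: a Z n.+1.
  rewrite /a -scalemxAr exprSm scalerA factS natrM invfM mulrA divff ?mul1r //.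
split.
  (* exp D = 1 + D M with M commuting with D, so D M is nilpotent and a finite geometric series
     gives the inverse. *)
  pose M := \sum_(k < m) (k.+1`!%:R)^-1 *: D ^+ k.
  have -> : expJ D = 1 - (- D) * M.
    rewrite (exp_poly m.+1) // big_ord_recl /= fact0 invr1 scale1r expr0 mulNr opprK.
    congr (_ + _); rewrite /M mulr_sumr; apply: eq_bigr => k _.
    by rewrite /bump /= add1n -scalerAr exprS.
  have DM : GRing.comm D M.
    by apply: commr_sum => k _; rewrite /GRing.comm -scalerAr -scalerAl -exprS -exprSr.
  pose z := - D * M.
  have zm : z ^+ m = 0.
    by rewrite /z mulNr exprNn exprMn_comm // Dm mul0r mulr0.
  have : (1 - z) * (\sum_(i < m) z ^+ i) = 1.
    by have := subrX1 z m; rewrite zm sub0r => /(congr1 -%R); rewrite opprK -mulNr opprB => <-.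
  by move=> /mulmx1_unit [].
move=> X Y; rewrite (exp_a (m + m)%N) ?leq_addr // (exp_a m X) // (exp_a m Y) //.
have c_ab k : a (jordan X Y) k = \sum_(i < k.+1) jordan (a X i) (a Y (k - i)%N).
  apply: (@leibniz_divided _ (@jordan R) (mulmx D)).
  - exact: mulmxDr.
  - exact: jordanDl.
  - exact: jordanDr.
  - exact: jordanZl.
  - exact: jordanZr.
  - exact: dD.
  - exact: Da.
  - exact: Da.
  - exact: Da.
  - by rewrite /a fact0 invr1 !scale1r expr0 !mul1mx.
rewrite (eq_bigr _ (fun (k : 'I_(m + m)) _ => c_ab k)).
rewrite (@cauchy_product _ (fun i j => jordan (a X i) (a Y j))).
- have J0l Z : jordan 0 Z = 0 by have := jordanZl 0 0 Z; rewrite !scale0r.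
  have J0r Z : jordan Z 0 = 0 by rewrite jordanC J0l.
  rewrite (big_morph (fun Z => jordan Z _) (fun Z Z' => jordanDl Z Z' _) (J0l _)).
  by apply: eq_bigr => i _; rewrite (big_morph _ (jordanDr _) (J0r _)).
- by move=> i j mi; rewrite a0 //; have := jordanZl 0 0 (a Y j); rewrite !scale0r.
- by move=> i j mj; rewrite (a0 Y) //; have := jordanZr 0 (a X i) 0; rewrite !scale0r.
Qed.

End NilpotentExponential.

(** * Exponentials of diagonalizable derivations *)

Section DiagonalizableExponential.
Variable R : realType.
Implicit Types (x y p q : oct R) (X Y Z : J1 R) (g D : endJ R) (t : R).

Lemma cvg_entry_seq m n (u : nat -> 'M[R]_(m, n)) (M : 'M[R]_(m, n)) i j :
  u @ \oo --> M -> (fun k => u k i j) @ \oo --> M i j.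
Proof.
move=> uM; have FF : Filter (fmap u \oo) by exact: fmap_filter.
have := @cvg_entry R m n (fmap u \oo) M i j FF uM; exact.
Qed.

(** Diagonalizability over the reals, stated without the choice of an eigenbasis. *)
Definition eigenspanned D := forall X, exists (n : nat) (nu : 'I_n -> R) (e : 'I_n -> J1 R),
  (forall i, D *m e i = nu i *: e i) /\ X = \sum_i e i.

Lemma eigen_ext D (E E' : endJ R) : eigenspanned D ->
  (forall nu Z, D *m Z = nu *: Z -> E *m Z = E' *m Z) -> E = E'.
Proof.
move=> sD EE; apply: eq_endJ => X; have [n [nu [e [De ->]]]] := sD X.
by rewrite !mulmx_sumr; apply: eq_bigr => i _; exact: EE (De i).
Qed.

Lemma eigenspannedZ t D : eigenspanned D -> eigenspanned (t *: D).
Proof.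
move=> sD X; have [n [nu [e [De ->]]]] := sD X.
exists n, (fun i => t * nu i), e; split=> // i.
by rewrite -scalemxAl De scalerA.
Qed.

(** A value of [limn] is usable only once convergence is known. Each column of the series converges
    because a basis vector is a finite sum of eigenvectors; the limit is assembled by columns. *)
Lemma cvg_expJ D : eigenspanned D -> series (fun n => (n`!%:R)^-1 *: D ^+ n) @ \oo --> expJ D.
Proof.
move=> sD; set S := series _.
have col_cvg X : exists L : J1 R, (fun n => S n *m X) @ \oo --> L.
  have [n [nu [e [De ->]]]] := sD X; exists (\sum_i expR (nu i) *: e i).
  apply: cvg_mx_entries => r c.
  change ((fun n => (S n *m \sum_i e i) r c) @ \oo --> (\sum_i expR (nu i) *: e i) r c).
  rewrite summxE (_ : (fun _ => _) = fun n => \sum_i (S n *m e i) r c).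
    by apply: cvg_sumr => i; have := @cvg_entry_seq _ _ _ _ r c (cvg_expJ_eigen (De i)); exact.
  by apply/funext => k; rewrite mulmx_sumr summxE.
pose L : endJ R := \matrix_(i, j) sval (cid (col_cvg (delta_mx j 0))) i 0.
have SL : S @ \oo --> L.
  apply: cvg_mx_entries => i j; rewrite mxE.
  have := @cvg_entry_seq _ _ _ _ i 0 (svalP (cid (col_cvg (delta_mx j 0)))).
  change ((fun n => (S n *m delta_mx j 0 : J1 R) i 0) @ \oo -->
      sval (cid (col_cvg (delta_mx j 0))) i 0 ->
    (fun n => S n i j) @ \oo --> sval (cid (col_cvg (delta_mx j 0))) i 0).
  have -> : (fun n => (S n *m delta_mx j 0 : J1 R) i 0) = fun n => S n i j.
    by apply/funext => n; rewrite -colE mxE.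
  exact.
have := cvgP _ SL; exact.
Qed.

(** Both sides are limits of the partial sums applied to Z. *)
Lemma expJ_eigen D nu Z : eigenspanned D -> D *m Z = nu *: Z -> expJ D *m Z = expR nu *: Z.
Proof.
move=> sD DZ; have c1 := cvg_expJ_eigen DZ.
set S := series _ in c1.
have c2 : (fun n => S n *m Z) @ \oo --> expJ D *m Z.
  have FF : Filter (fmap S \oo) by exact: fmap_filter.
  have := @cvg_mulmx R 27 27 1 (fmap S \oo) (expJ D) Z FF (cvg_expJ sD); exact.
have [e1 e2] := (cvg_lim (@norm_hausdorff _ _) c1, cvg_lim (@norm_hausdorff _ _) c2).
by rewrite -e1 -e2.
Qed.

Lemma expJ_Nl D : eigenspanned D -> expJ (- D) *m expJ D = 1%:M.
Proof.
move=> sD; have sN : eigenspanned (- D) by rewrite -scaleN1r; exact: eigenspannedZ.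
apply: (eigen_ext sD) => nu Z DZ; rewrite -mulmxA (expJ_eigen sD DZ) -scalemxAr mul1mx.
rewrite (@expJ_eigen (- D) (- nu)) //; last by rewrite mulNmx DZ scaleNr.
by rewrite scalerA -expRD subrr expR0 scale1r.
Qed.

(** By bilinearity it suffices to treat eigenvectors: a derivation adds eigenvalues under the Jordan
    product, and exp turns the sum into a product. *)
Lemma expJ_eigenspanned_F4 D : derivation D -> eigenspanned D -> F4 (expJ D).
Proof.
move=> dD sD; split; first by have /mulmx1_unit [] := expJ_Nl sD.
move=> X Y; have [n [nu [e [De ->]]]] := sD X; have [m [mu [f [Df ->]]]] := sD Y.
have J0l Z : jordan 0 Z = 0 by have := jordanZl 0 0 Z; rewrite !scale0r.
have J0r Z : jordan Z 0 = 0 by rewrite jordanC J0l.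
have Jsl k (u : 'I_k -> J1 R) Z : jordan (\sum_i u i) Z = \sum_i jordan (u i) Z.
  exact: (big_morph (fun W => jordan W Z) (fun W W' => jordanDl W W' Z) (J0l Z)).
have Jsr k (u : 'I_k -> J1 R) Z : jordan Z (\sum_i u i) = \sum_i jordan Z (u i).
  exact: (big_morph (jordan Z) (jordanDr Z) (J0r Z)).
rewrite !mulmx_sumr !Jsl mulmx_sumr; apply: eq_bigr => i _.
rewrite !Jsr mulmx_sumr; apply: eq_bigr => j _.
rewrite (expJ_eigen sD (De i)) (expJ_eigen sD (Df j)) jordanZl jordanZr scalerA -expRD.
apply: expJ_eigen; first exact: sD.
by rewrite (dD (e i) (f j)) (De i) (Df j) jordanZl jordanZr -scalerDl.
Qed.

End DiagonalizableExponential.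

(** * Eigenspaces of A_3^1(1) *)

Section BoostEigenvectors.
Variable R : realType.
Implicit Types (x y p q : oct R) (X Y Z : J1 R) (g D : endJ R) (t : R).

Lemma oip1l x : oip (oe R 0) x = ore x.
Proof. by oct_destruct; oct_simp; ring. Qed.

Lemma A3_one_h1 a b c x y z : A3 (oe R 0) *m h1 a b c x y z =
  h1 (- (2 * ore z)) (2 * ore z) 0 (oconj y) (oconj x) ((b - a) *: oe R 0).
Proof.
have [e1 e2] := (omul_oneP x, omul_oneP y).
have neg : - ((a - b) *: oe R 0) = (b - a) *: oe R 0 by rewrite -scaleNr opprB.
by rewrite A3_h1 oip1l (proj1 e1) (proj2 e2) neg.
Qed.

Lemma A3_one_eigen2 r : let Z := h1 (- r) r 0 0 0 (r *: oe R 0) in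
  A3 (oe R 0) *m Z = 2 *: Z.
Proof.
rewrite /= A3_one_h1 h1Z oconj0 scaler0; apply: eq_h1; try by [].
all: oct_simp; first [ring|congr oct8; ring].
Qed.

Lemma A3_one_eigenN2 r : let Z := h1 (- r) r 0 0 0 (- r *: oe R 0) in
  A3 (oe R 0) *m Z = - 2 *: Z.
Proof.
rewrite /= A3_one_h1 h1Z oconj0 scaler0; apply: eq_h1; try by [].
all: oct_simp; first [ring|congr oct8; ring].
Qed.

Lemma A3_one_eigen0 r c p : oIm p -> let Z := h1 r r c 0 0 p in
  A3 (oe R 0) *m Z = 0 *: Z.
Proof.
move=> p0; rewrite /= A3_one_h1 h1Z oconj0 !mul0r !scale0r (_ : ore p = 0) //.
by rewrite mulr0 oppr0 subrr scale0r.
Qed.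

Lemma A3_one_eigen1 x : let Z := h1 0 0 0 x (oconj x) 0 in
  A3 (oe R 0) *m Z = 1 *: Z.
Proof.
rewrite /= A3_one_h1 scale1r oconjK; apply: eq_h1; [| |by []|by []|by []|].
all: by oct_simp; first [ring|congr oct8; ring].
Qed.

Lemma A3_one_eigenN1 x : let Z := h1 0 0 0 x (- oconj x) 0 in
  A3 (oe R 0) *m Z = - 1 *: Z.
Proof.
rewrite /= A3_one_h1 scaleN1r h1N oconjN oconjK opprK oppr0; apply: eq_h1; [| |by []|by []|by []|].
all: by oct_simp; first [ring|congr oct8; ring].
Qed.

Lemma eigenspanned_A3_one : eigenspanned (A3 (oe R 0)).
Proof.
move=> X; case: (h1P X) => a b c x y z.
(* Here al + be = (b - a)/2 and al - be = Re z, while u + v = x and u - v is the conjugate of y. *)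
pose al := ((b - a) / 2 + ore z) / 2; pose be := ((b - a) / 2 - ore z) / 2.
pose u := 2^-1 *: (x + oconj y); pose v := 2^-1 *: (x - oconj y).
pose e (i : 'I_5) := nth 0 [:: h1 (- al) al 0 0 0 (al *: oe R 0);
  h1 (- be) be 0 0 0 (- be *: oe R 0);
  h1 ((a + b) / 2) ((a + b) / 2) c 0 0 (z - ore z *: oe R 0);
  h1 0 0 0 u (oconj u) 0; h1 0 0 0 v (- oconj v) 0] i.
exists 5%N, (fun i => nth 0 [:: 2; - 2; 0; 1; - 1] i), e; split.
  rewrite /e => -[[|[|[|[|[|//]]]]] /= _].
  - exact: A3_one_eigen2.
  - exact: A3_one_eigenN2.
  - apply: A3_one_eigen0; rewrite /oIm; clear; oct_destruct.
    by oct_simp; ring.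
  - exact: A3_one_eigen1.
  - exact: A3_one_eigenN1.
rewrite !big_ord_recl big_ord0 /e /= addr0 !h1D /u /v /al /be; clear.
do 3 oct_destruct.
by h1_field.
Qed.

End BoostEigenvectors.

(** * Explicit action of G_1(x) + G_2(p) *)

Section UnipotentGenerators.
Variable R : realType.
Implicit Types (x y p q : oct R) (X Y Z : J1 R) (g D : endJ R) (t : R).

Lemma G12_h1 x p a b c u v w : (G1 x + G2 p) *m h1 a b c u v w =
  h1 (2 * oip p w - 2 * oip (oconj x) v) (2 * oip x u - 2 * oip p w)
     (2 * oip (oconj x) v - 2 * oip x u)
     ((c - b) *: x + oconj (oconj x * w)%oct - oconj (v * p)%oct - (p * u)%oct)
     ((c - a) *: oconj x - oconj (w * x)%oct - oconj (p * u)%oct - (v * p)%oct)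
     (oconj (x * v)%oct + oconj (u * oconj x)%oct + (a - b) *: p + (p * w)%oct + (w * p)%oct).
Proof.
rewrite !mulmxDl mulNmx A1_h1 A2_h1 A3_h1 deltaJ_h1 h1N !h1D.
by do 5 oct_destruct; h1_field.
Qed.

End UnipotentGenerators.

(** * G_1(x) + G_2(p) as a raising operator *)

Section UnipotentFiltration.
Variable R : realType.
Implicit Types (x y p q : oct R) (X Y Z : J1 R) (g D : endJ R) (t : R).

(** The multiple r P^-; these form the eigenspace of A_3^1(1) for the top eigenvalue 2. *)
Definition Pm (r : R) : J1 R := h1 (- r) r 0 0 0 (r *: oe R 0).

Lemma G12_Pminus x p r : oIm p -> (G1 x + G2 p) *m Pm r = 0.
Proof.
rewrite /oIm /Pm G12_h1 -h10; do 2 oct_destruct; rewrite oct8_re => ->.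
by h1_field.
Qed.

Lemma G12_Qplus x p u : oIm p -> (G1 x + G2 p) *m Qplus u = Pm (2 * oip x u).
Proof.
rewrite /oIm /Qplus /Pm G12_h1; do 3 oct_destruct; rewrite oct8_re => ->.
by h1_field.
Qed.

(** From eigenvalue 0, G_1(x) raises by one to a Q^+ and G_2(p) by two to a multiple of P^-. *)
Lemma G12_F3 x p q : oIm p -> oIm q ->
  (G1 x + G2 p) *m F3 q = Qplus (- (q * x)%oct) + Pm (- (2 * oip p q)).
Proof.
rewrite /oIm /F3 /Qplus /Pm G12_h1 h1D; do 3 oct_destruct; rewrite !oct8_re => -> ->.
by h1_field.
Qed.

(* The next three lemmas say that G_1(x) + G_2(p) raises the filtration of J^1 by the
   eigenvalues of A_3^1(1); the condition b - a = 2 Re w cuts out the eigenvalues >= -1. *)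
Lemma G12_eigen_geN1 x p a b c u v w : oIm p -> exists r s c' u' v' w',
  (G1 x + G2 p) *m h1 a b c u v w = h1 (r - s) (r + s) c' u' v' w' /\ ore w' = s.
Proof.
move=> p0; rewrite G12_h1.
set a' := 2 * _ - _; set b' := 2 * oip x u - _; set c' := 2 * oip _ _ - _.
set u' := _ - (p * u)%oct; set v' := _ - (v * p)%oct; set w' := _ + (w * p)%oct.
exists ((a' + b') / 2), ((b' - a') / 2), c', u', v', w'; split.
  by apply: eq_h1 => //; field.
rewrite /w' /a' /b'; clear -p0; move: p0; rewrite /oIm; do 5 oct_destruct; rewrite oct8_re => ->.
by oct_simp; field.
Qed.

Lemma G12_eigen_ge0 x p r c u v w : oIm p -> exists r' c' u' w',
  (G1 x + G2 p) *m h1 (r - ore w) (r + ore w) c u v w =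
    h1 (r' - ore w') (r' + ore w') c' u' (oconj u') w'.
Proof.
move=> p0; have := G12_eigen_geN1 x (r - ore w) (r + ore w) c u v w p0.
move=> [r' [s [c' [u' [v' [w' [e ws]]]]]]]; exists r', c', u', w'; rewrite e ws.
apply: eq_h1; [by []|by []|by []|by []| |by []].
move: e; rewrite G12_h1 => e.
have := congr1 (@ox1 R) e; have := congr1 (@ox2 R) e; rewrite !h1_coords => <- <-.
clear -p0; move: p0; rewrite /oIm; do 5 oct_destruct; rewrite oct8_re => ->.
by oct_simp; congr oct8; ring.
Qed.

Lemma G12_eigen_ge1 x p r c u w : oIm p -> exists u' m,
  (G1 x + G2 p) *m h1 (r - ore w) (r + ore w) c u (oconj u) w = Qplus u' + Pm m.
Proof.
move=> p0; rewrite G12_h1.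
exists ((c - (r + ore w)) *: x + oconj (oconj x * w)%oct - oconj (oconj u * p)%oct - (p * u)%oct).
exists (2 * oip x u - 2 * oip p w); rewrite /Qplus /Pm h1D.
move: p0; rewrite /oIm; do 4 oct_destruct; rewrite oct8_re => ->.
by h1_field.
Qed.

(** Successive images lie in the eigenvalues >= -1, >= 0 and >= 1, then on the line of P^-, and the
    fifth is 0. *)
Lemma G12_nilpotent x p : oIm p -> (G1 x + G2 p) ^+ 5 = 0.
Proof.
move=> p0; apply: eq_endJ => X; rewrite !exprSm expr0 mul1mx mul0mx.
case: (h1P X) => a b c u v w.
have [r [s [c1 [u1 [v1 [w1 [-> <-]]]]]]] := G12_eigen_geN1 x a b c u v w p0.
have [r2 [c2 [u2 [w2 ->]]]] := G12_eigen_ge0 x r c1 u1 v1 w1 p0.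
have [u3 [m ->]] := G12_eigen_ge1 x r2 c2 u2 w2 p0.
by rewrite mulmxDr G12_Qplus // G12_Pminus // addr0 G12_Pminus.
Qed.

End UnipotentFiltration.

(** * Action of A and N^+ on P^-, Q^+(u) and F_3^1(q) *)

Section ExponentialAction.
Variable R : realType.
Implicit Types (x y p q : oct R) (X Y Z : J1 R) (g D : endJ R) (t : R).

Lemma Pminus_Pm : Pminus R = Pm 1.
Proof. by rewrite /Pm scale1r. Qed.

Lemma PmE (r : R) : Pm r = r *: Pm 1.
Proof. by rewrite /Pm h1Z !mulr0 !scaler0 scale1r mulrN1 mulr1. Qed.

(** Multiplication by an imaginary octonion is skew for the inner product. *)
Lemma oip_imM x q : oIm q -> oip x (- (q * x)%oct) = 0.
Proof. by rewrite /oIm; do 2 oct_destruct; rewrite oct8_re => ->; oct_simp; ring. Qed.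

Section Boost.
Variable t : R.
Let A := expJ (t *: A3 (oe R 0)).

Lemma boost_F4 : F4 A.
Proof.
apply: expJ_eigenspanned_F4; first by apply: derivationZ; exact: A3_derivation.
apply: eigenspannedZ; exact: eigenspanned_A3_one.
Qed.

Lemma boost_eigen nu Z : A3 (oe R 0) *m Z = nu *: Z -> A *m Z = expR (t * nu) *: Z.
Proof.
move=> TZ; rewrite /A; apply: expJ_eigen.
  by apply: eigenspannedZ; exact: eigenspanned_A3_one.
by rewrite -scalemxAl TZ scalerA.
Qed.

Lemma boost_Pm (r : R) : A *m Pm r = expR (t * 2) *: Pm r.
Proof. exact: boost_eigen (A3_one_eigen2 r). Qed.

Lemma boost_Qplus u : A *m Qplus u = expR t *: Qplus u.
Proof. by rewrite (boost_eigen (A3_one_eigen1 u)) mulr1. Qed.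

Lemma boost_F3 q : oIm q -> A *m F3 q = F3 q.
Proof. by move=> q0; rewrite (boost_eigen (A3_one_eigen0 0 0 q0)) mulr0 expR0 scale1r. Qed.

End Boost.

(** D^3 Z = 0, so the exponential series stops at order two. *)
Lemma expJ_nilpotent2 D Z Z' Z2 : D ^+ 5 = 0 -> D *m Z = Z' -> D *m Z' = Z2 -> D *m Z2 = 0 ->
  expJ D *m Z = Z + Z' + 2^-1 *: Z2.
Proof.
move=> D5 DZ DZ' DZ2; have P n : D ^+ n.+3 *m Z = 0.
  by elim: n => [|n IH]; rewrite exprSm ?IH ?mulmx0 // !exprSm expr0 mul1mx DZ DZ'.
rewrite (expJ_nilpotent D5) !big_ord_recl big_ord0 /bump /= !mulmxDl mul0mx.
rewrite -!scalemxAl !P !scaler0 !addr0 !exprSm !expr0 !mul1mx DZ DZ' !addrA.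
by rewrite fact0 invr1 !scale1r.
Qed.

Section Unipotent.
Variables x p : oct R.
Hypothesis p0 : oIm p.
Let n := expJ (G1 x + G2 p).

Lemma unipotent_F4 : F4 n.
Proof.
apply: (@expJ_nilpotent_F4 _ _ 5); last exact: G12_nilpotent.
by apply: derivationD; [exact: G1_derivation|exact: G2_derivation].
Qed.

Lemma unipotent_Pm (r : R) : n *m Pm r = Pm r.
Proof.
rewrite (expJ_nilpotent2 (G12_nilpotent x p0) (G12_Pminus x r p0) (mulmx0 _ _) (mulmx0 _ _)).
by rewrite scaler0 !addr0.
Qed.

Lemma unipotent_Qplus u : n *m Qplus u = Qplus u + Pm (2 * oip x u).
Proof.
have z := G12_Pminus x (2 * oip x u) p0.
by rewrite (expJ_nilpotent2 (G12_nilpotent x p0) (G12_Qplus x u p0) z (mulmx0 _ _)) scaler0 addr0.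
Qed.

(** The second order term is a multiple of (x|qx) P^-, which vanishes by skewness. *)
Lemma unipotent_F3 q : oIm q ->
  n *m F3 q = F3 q + (Qplus (- (q * x)%oct) + Pm (- (2 * oip p q))).
Proof.
move=> q0; have qx := oip_imM x q0.
have z : (G1 x + G2 p) *m (Qplus (- (q * x)%oct) + Pm (- (2 * oip p q))) = 0.
  by rewrite mulmxDr (G12_Qplus _ _ p0) (G12_Pminus _ _ p0) qx mulr0 addr0 PmE scale0r.
rewrite (expJ_nilpotent2 (G12_nilpotent x p0) (G12_F3 x p0 q0) z (mulmx0 _ _)).
by rewrite scaler0 addr0.
Qed.

End Unipotent.

End ExponentialAction.

(** * Recovery of the three factors from g, and their uniqueness *)

Section IwasawaCoordinates.
Variable R : realType.
Implicit Types (x y p q : oct R) (X Y Z : J1 R) (g D : endJ R) (t : R).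

Lemma ipJ_h1 a b c x y z a' b' c' x' y' z' :
  ipJ (@h1 R a b c x y z) (h1 a' b' c' x' y' z') =
  a * a' + b * b' + c * c' + 2 * oip x x' - 2 * oip y y' - 2 * oip z z'.
Proof. by rewrite ipJE !h1_coords. Qed.

Lemma oip0r x : oip x 0 = 0.
Proof. by rewrite oipC -(scale0r 0) oipZl mul0r. Qed.

Lemma trJD X Y : trJ (X + Y) = trJ X + trJ Y.
Proof.
case: (h1P X) => a b c x y z; case: (h1P Y) => a' b' c' x' y' z'.
by rewrite h1D /trJ !h1_coords; ring.
Qed.

Lemma trJZ t X : trJ (t *: X) = t * trJ X.
Proof. by case: (h1P X) => a b c x y z; rewrite h1Z /trJ !h1_coords; ring. Qed.

Lemma ipJDl X Y Z : ipJ (X + Y) Z = ipJ X Z + ipJ Y Z.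
Proof. by rewrite /ipJ jordanDl trJD. Qed.

Lemma ipJZl t X Z : ipJ (t *: X) Z = t * ipJ X Z.
Proof. by rewrite /ipJ jordanZl trJZ. Qed.

Lemma ipJ_E2 Y : ipJ Y (E2 R) = xi2 Y.
Proof. by rewrite ipJE /E2 !h1_coords !oip0r; ring. Qed.

(** k fixes E_2 and preserves the form, so it drops out of pairings with E_2. *)
Lemma ipJ_Keps_E2 k Y : Keps k -> ipJ (k *m Y) (E2 R) = xi2 Y.
Proof. by move=> [Fk kE]; rewrite -[X in ipJ _ X]kE ipJ_F4 // ipJ_E2. Qed.

Lemma oip_oe x i : oip x (oe R i) = x 0 i.
Proof.
rewrite oip_sum (bigD1 i) //= big1 ?addr0; first by rewrite mxE !eqxx mulr1.
by move=> j ji; rewrite mxE eqxx /= (negPf ji) mulr0.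
Qed.

Lemma oe_imag i : i != 0 -> oIm (oe R i).
Proof. by move=> i0; rewrite /oIm /ore mxE eqxx eq_sym (negPf i0). Qed.

Section Coordinates.
Variables (k : endJ R) (t : R) (x p : oct R).
Hypotheses (kK : Keps k) (p0 : oIm p).
Let g := k *m expJ (t *: A3 (oe R 0)) *m expJ (G1 x + G2 p).

Lemma iwasawa_Pm (r : R) : ipJ (g *m Pm r) (E2 R) = expR (t * 2) * r.
Proof.
rewrite /g -(mulmxA (k *m _)) -(mulmxA k) (unipotent_Pm x p0) boost_Pm.
by rewrite (ipJ_Keps_E2 _ kK) h1Z h1_coords.
Qed.

(** Only the component of n Q^+(u) along P^- has a nonzero [xi2], and it is linear in x.
    [iwasawa_F3] reads off p in the same way. *)
Lemma iwasawa_Qplus u : ipJ (g *m Qplus u) (E2 R) = expR (t * 2) * (2 * oip x u).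
Proof.
rewrite /g -(mulmxA (k *m _)) -(mulmxA k) (unipotent_Qplus x p0) mulmxDr boost_Pm boost_Qplus.
by rewrite (ipJ_Keps_E2 _ kK) !h1Z h1D h1_coords; ring.
Qed.

Lemma iwasawa_F3 q : oIm q -> ipJ (g *m F3 q) (E2 R) = - (expR (t * 2) * (2 * oip p q)).
Proof.
move=> q0; rewrite /g -(mulmxA (k *m _)) -(mulmxA k) (unipotent_F3 x p0 q0).
rewrite !mulmxDr boost_Pm boost_Qplus boost_F3 // -!mulmxDr.
by rewrite (ipJ_Keps_E2 _ kK) !h1Z !h1D h1_coords; ring.
Qed.

End Coordinates.

Lemma iwasawa_F4 g k H n : iwasawa g k H n -> F4 g.
Proof.
move=> [[Fk _] [t _ <-] [x [p [p0 ->]]] ->].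
exact (F4_mul (F4_mul Fk (boost_F4 t)) (unipotent_F4 x p0)).
Qed.

Lemma iwasawa_gt0 g k H n : iwasawa g k H n -> 0 < ipJ (g *m Pminus R) (E2 R).
Proof.
move=> [Kk [t _ <-] [x [p [p0 ->]]] ->].
by rewrite Pminus_Pm iwasawa_Pm // mulr1 expR_gt0.
Qed.

(** The pairings with E_2 of gP^-, gQ^+(e_i) and gF_3^1(e_i) determine t, x and p in turn, so
    uniqueness and the explicit formulas come together. *)
Lemma iwasawa_unique g k H n : iwasawa g k H n ->
  [/\ H = H_eps g, n = n_eps g & k = k_eps g].
Proof.
move=> [Kk [t _ <-] [x [p [p0 ->]]] ->]; set g' := (X in H_eps X).
have Q u : ipJ (g' *m Qplus u) (E2 R) = expR (t * 2) * (2 * oip x u) by exact: iwasawa_Qplus.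
have F q : oIm q -> ipJ (g' *m F3 q) (E2 R) = - (expR (t * 2) * (2 * oip p q)).
  by move=> q0; exact: iwasawa_F3.
have m_e : ipJ (g' *m Pminus R) (E2 R) = expR (t * 2).
  by rewrite Pminus_Pm iwasawa_Pm // mulr1.
have e0 : expR (t * 2) != 0 by rewrite gt_eqF // expR_gt0.
have HE : t *: A3 (oe R 0) = H_eps g'.
  by rewrite /H_eps m_e expRK; congr (_ *: _); field.
have nE : expJ (G1 x + G2 p) = n_eps g'.
  have xE : (2^-1 / expR (t * 2)) *: (\sum_(i < 8) ipJ (g' *m Qplus (oe R i)) (E2 R) *: oe R i) = x.
    rewrite [RHS]row_sum_delta scaler_sumr; apply: eq_bigr => i _.
    by rewrite Q oip_oe scalerA /oe; congr (_ *: _); field.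
  have pE : (- (2^-1 / expR (t * 2))) *:
      (\sum_(i < 8 | i != 0) ipJ (g' *m F3 (oe R i)) (E2 R) *: oe R i) = p.
    (* The e_0 term drops out because p is imaginary. *)
    rewrite [RHS]row_sum_delta [RHS](bigD1 0) //= [p 0 0]p0 scale0r add0r scaler_sumr.
    apply: eq_bigr => i i0; rewrite F ?oip_oe; last exact: oe_imag.
    by rewrite scalerA /oe; congr (_ *: _); field.
  by rewrite /n_eps m_e xE pE.
split; [exact: HE|exact: nE|rewrite /k_eps -nE -HE /g'].
have [nU _] := unipotent_F4 x p0.
rewrite (mulmxK nU); set D := t *: _.
have sD : eigenspanned (- D).
  by rewrite /D -scaleNr; apply: eigenspannedZ; exact: eigenspanned_A3_one.
by have := expJ_Nl sD; rewrite opprK -mulmxA => ->; rewrite mulmx1.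
Qed.

End IwasawaCoordinates.

(** * Normalization of an element of J^1 by N^+ *)

Section UnipotentNormalization.
Variable R : realType.
Implicit Types (x y p q : oct R) (X Y Z : J1 R) (g D : endJ R) (t : R).

Lemma oip_ge0 x : 0 <= oip x x.
Proof. by rewrite oip_sum; apply: sumr_ge0 => i _; rewrite -expr2 sqr_ge0. Qed.

Lemma oip_eq0 x : oip x x = 0 -> x = 0.
Proof.
rewrite oip_sum => /eqP; rewrite psumr_eq0; last by move=> i _; rewrite -expr2 sqr_ge0.
move=> /allP x0; apply/rowP => i; rewrite mxE; apply/eqP.
by have := x0 i (mem_index_enum i); rewrite -expr2 sqrf_eq0.
Qed.

(** (Q^+(u)|nX) = (n^-1 Q^+(u)|X), and n^-1 changes Q^+(u) by a multiple of P^-. As (P^-|X) is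
    nonzero, x can be solved for, and p likewise from F_3^1(q). *)
Lemma unipotent_orthogonal X : ipJ (Pm 1) X != 0 -> exists x p, oIm p /\
  let Y := expJ (G1 x + G2 p) *m X in
  (forall u, ipJ (Qplus u) Y = 0) /\ (forall q, oIm q -> ipJ (F3 q) Y = 0).
Proof.
set m := ipJ _ _ => m0.
(* The solutions of (Q^+(u)|X) = 2m(x|u) and (F_3^1(q)|X) = -2m(p|q). *)
pose x := m^-1 *: (ox1 X - oconj (ox2 X)).
pose p := m^-1 *: (ox3 X - ore (ox3 X) *: oe R 0); exists x, p.
have p0 : oIm p.
  rewrite /oIm /p; case: (h1P X) => a b c u v w; rewrite !h1_coords; clear; oct_destruct.
  by oct_simp; ring.
split=> //; move: (unipotent_F4 x p0) => Fn.
have Q u : ipJ (Qplus u) X = 2 * oip x u * m.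
  have -> : 2 * oip x u * m = 2 * oip (ox1 X - oconj (ox2 X)) u.
    by rewrite /x oipZl; field.
  case: (h1P X) => a b c v1 v2 v3; rewrite /Qplus ipJ_h1 !h1_coords; clear.
  by do 4 oct_destruct; oct_simp; ring.
have F q : oIm q -> ipJ (F3 q) X = - (2 * oip p q * m).
  move=> q0; have -> : 2 * oip p q * m = 2 * oip (ox3 X - ore (ox3 X) *: oe R 0) q.
    by rewrite /p oipZl; field.
  case: (h1P X) => a b c v1 v2 v3; rewrite /F3 ipJ_h1 !h1_coords; clear -q0.
  by move: q0; rewrite /oIm; do 4 oct_destruct; rewrite oct8_re => ->; oct_simp; ring.
have Qn u : ipJ (Qplus u) (expJ (G1 x + G2 p) *m X) = 0.
  (* The vector in parentheses is n^-1 Q^+(u). *)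
  have -> : Qplus u = expJ (G1 x + G2 p) *m (Qplus u + Pm (- (2 * oip x u))).
    rewrite mulmxDr (unipotent_Qplus _ p0) (unipotent_Pm _ p0) -addrA.
    by rewrite (PmE (2 * _)) (PmE (- _)) -scalerDl subrr scale0r addr0.
  by rewrite (ipJ_F4 _ _ Fn) ipJDl Q PmE ipJZl -/m; ring.
split=> // q q0.
(* The vector in parentheses is n^-1 F_3^1(q); its Q^+ term is orthogonal to X because (x|qx) =
   0. *)
have -> : F3 q = expJ (G1 x + G2 p) *m (F3 q + Qplus (q * x)%oct + Pm (2 * oip p q)).
  rewrite !mulmxDr (unipotent_F3 _ p0 q0) (unipotent_Qplus _ p0) (unipotent_Pm _ p0).
  have := oip_imM x q0; move: (omul q x) => v v0.
  have -> : oip x v = 0 by have := v0; rewrite -scaleN1r oipC oipZl oipC; lra.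
  rewrite /F3 /Qplus /Pm !h1D oconjN mulr0 !scale0r scaleNr.
  apply: eq_h1; rewrite ?addr0 ?add0r; [ring|ring|ring|..].
  - by rewrite addNr.
  - by rewrite addNr.
  - by rewrite addrNK.
rewrite (ipJ_F4 _ _ Fn) !ipJDl F // Q (PmE (2 * _)) ipJZl -/m.
have := oip_imM x q0; move: (omul q x) => v v0.
have -> : oip x v = 0 by have := v0; rewrite -scaleN1r oipC oipZl oipC; lra.
ring.
Qed.

End UnipotentNormalization.

(** * Normal form of idempotents of trace 1 *)

Section IdempotentNormalForm.
Variable R : realType.
Implicit Types (x y p q : oct R) (X Y Z : J1 R) (g D : endJ R) (t : R).

(** Orthogonality makes v the conjugate of u and w = s real. Idempotency and the trace then leave u
    = 0 and c = 0, since any other case forces (P^-|Y) = b - a - 2s to vanish. *)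
Lemma idempotent_normal Y : jordan Y Y = Y -> trJ Y = 1 ->
  (forall u, ipJ (Qplus u) Y = 0) -> (forall q, oIm q -> ipJ (F3 q) Y = 0) ->
  ipJ (Pm 1) Y != 0 ->
  exists a s, Y = h1 a (1 - a) 0 0 0 (s *: oe R 0) /\ a = a ^+ 2 - s ^+ 2.
Proof.
case: (h1P Y) => a b c u v w YY; rewrite /trJ !h1_coords => tr Q F m0.
have vE : v = oconj u.
  have : oip (oconj u - v) (oconj u - v) = 0.
    (* At this argument the pairing is twice the squared norm of [oconj u - v]. *)
    have := Q (oconj (oconj u - v)); rewrite /Qplus ipJ_h1 oconjK.
    clear; do 3 oct_destruct; oct_simp => H; lra.
  by move=> /oip_eq0 /eqP; rewrite subr_eq0 => /eqP.
have wE : w = ore w *: oe R 0.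
  have q0 : oIm (w - ore w *: oe R 0) by rewrite /oIm; clear; oct_destruct; oct_simp; ring.
  have : oip (w - ore w *: oe R 0) (w - ore w *: oe R 0) = 0.
    have := F _ q0; rewrite /F3 ipJ_h1 (oipC 0 u) (oipC 0 v) !oip0r.
    clear; oct_destruct; oct_simp => H; lra.
  by move=> /oip_eq0 /eqP; rewrite subr_eq0 => /eqP.
move: wE; set s := ore w => wE.
move: m0; rewrite /Pm ipJ_h1 vE wE scale1r.
have -> : oip (oe R 0) (s *: oe R 0) = s by oct_simp; ring.
rewrite (oipC 0 u) (oipC 0 (oconj u)) !oip0r => m0.
move: YY; rewrite jordan_sq vE wE => E.
have [E1 E2'] := (congr1 (@xi1 R) E, congr1 (@xi2 R) E).
have [E3 E4] := (congr1 (@xi3 R) E, congr1 (fun Z => oip u (ox1 Z)) E).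
have [E5 E6] := (congr1 (fun Z => oip (oconj u) (ox2 Z)) E, congr1 (fun Z => ore (ox3 Z)) E).
have N0 := oip_ge0 u; have Nz : oip u u = 0 -> u = 0 by exact: oip_eq0.
move: E1 E2' E3 E4 E5 E6; rewrite !h1_coords oip_conj.
have -> : oip (s *: oe R 0) (s *: oe R 0) = s ^+ 2 by oct_simp; ring.
have -> : oip u ((b + c) *: u - oconj (oconj u * (s *: oe R 0))%oct) = (b + c - s) * oip u u.
  by clear; do 1 oct_destruct; oct_simp; ring.
have -> : oip (oconj u) ((a + c) *: oconj u + oconj ((s *: oe R 0) * u)%oct) =
    (a + c + s) * oip u u.
  by clear; do 1 oct_destruct; oct_simp; ring.
have -> : ore ((a + b) *: (s *: oe R 0) + oconj (u * oconj u)%oct) = (a + b) * s + oip u u.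
  by clear; do 1 oct_destruct; oct_simp; ring.
have -> : ore (s *: oe R 0) = s by oct_simp; ring.
move: N0 Nz; set N := oip u u => N0 Nz E1 E2' E3 E4 E5 E6.
have N_0 : N = 0.
  (* If N is nonzero, the x_1 and x_2 equations give a = -s and b = s. *)
  apply/eqP; apply: contraT => nN.
  have e1 : a + s = 0.
    by apply: (mulIf nN); rewrite mul0r; have := E4; rewrite (_ : b = 1 - a - c); [lra|lra].
  have e2 : b - s = 0.
    by apply: (mulIf nN); rewrite mul0r; have := E5; rewrite (_ : a = 1 - b - c); [lra|lra].
  by case/eqP: m0; lra.
have u0 : u = 0 by exact: Nz.
have c01 : (c == 0) || (c == 1).
  have : c * (c - 1) = 0 by have := E3; lra.
  by move=> /eqP; rewrite mulf_eq0 subr_eq0.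
have c0 : c = 0.
  (* If c = 1, then b = -a, the x_3 equation gives s = 0, and the first two diagonal equations give
     a = 0. *)
  case/orP: c01 => /eqP // c1; exfalso.
  have s0 : s = 0 by have := E6; rewrite N_0 (_ : a + b = 0); lra.
  have bE : b = - a by lra.
  have : a = 0 by have := E1; have := E2'; rewrite s0 N_0 bE; nra.
  by move=> a0; case/eqP: m0; rewrite s0 bE a0; ring.
exists a, s; rewrite u0 oconj0 c0; split; last by have := E1; rewrite N_0; lra.
by congr (h1 _ _ _ _ _ _); lra.
Qed.

End IdempotentNormalForm.

(** * The sign of (gP^-|E_2) and the existence of the factors *)

Section Existence.
Variable R : realType.
Implicit Types (x y p q : oct R) (X Y Z : J1 R) (g D : endJ R) (t : R).

(* The coefficients on P^- and P^+ = h^1(-1, 1, 0; 0, 0, -1) are 1/(4m) and m/4 before the boost. *)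
Lemma boost_normal a s : a = a ^+ 2 - s ^+ 2 -> let m := 1 - 2 * a - 2 * s in m != 0 ->
  expJ ((2^-1 * ln `|m|) *: A3 (oe R 0)) *m h1 a (1 - a) 0 0 0 (s *: oe R 0) =
  h1 ((1 - Num.sg m) / 2) ((1 + Num.sg m) / 2) 0 0 0 0.
Proof.
move=> as2 m m0; have am0 : `|m| != 0 by rewrite normr_eq0.
have am_gt0 : 0 < `|m| by rewrite normr_gt0.
pose al := (1 - 2 * a + 2 * s) / 4; pose be := m / 4.
(* The hypothesis says that (1 - 2a)^2 - 4s^2 = 1. *)
have alm : al * m = 4^-1.
  by rewrite /al /m; apply: (mulfI (_ : 4 != 0)); rewrite ?pnatr_eq0 // divff ?pnatr_eq0 //; lra.
have -> : h1 a (1 - a) 0 0 0 (s *: oe R 0) =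
    h1 2^-1 2^-1 0 0 0 0 + Pm al + h1 (- be) be 0 0 0 (- be *: oe R 0).
  rewrite /Pm !h1D !addr0 add0r -scalerDl /al /be /m.
  by apply: eq_h1; [by field|by field|by []|by []|by []|congr (_ *: _); field].
have q0 : oIm (0 : oct R) by rewrite /oIm /ore mxE.
rewrite !mulmxDr boost_Pm (boost_eigen _ (A3_one_eigen0 _ _ q0)) (boost_eigen _ (A3_one_eigenN2 _)).
have e1 : expR (2^-1 * ln `|m| * 2) = `|m| by rewrite mulrAC mulVf ?pnatr_eq0 // mul1r lnK.
have e2 : expR (2^-1 * ln `|m| * - 2) = `|m|^-1 by rewrite mulrN expRN e1.
rewrite e1 e2 mulr0 expR0 scale1r.
(* The boost scales the two coefficients by |m| and 1/|m|, and both become sg(m)/4. *)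
have f1 : `|m| * al = Num.sg m / 4.
  by apply: (mulIf m0); rewrite -mulrA alm [in LHS]normrEsg; field.
have f2 : `|m|^-1 * be = Num.sg m / 4.
  by apply: (mulfI am0); rewrite mulrA divff // mul1r /be normrEsg -!mulrA
    [in RHS](mulrCA m) !mulrA -expr2 sqr_sg m0 mul1r.
rewrite /Pm !h1Z !h1D !scalerA !mulrN f1 f2 !mulr0 !scaler0 !addr0.
apply: eq_h1; [by field|by field|by []|by []|by []|].
by rewrite add0r -scalerDl subrr scale0r.
Qed.

Lemma jordan_E2 : jordan (E2 R) (E2 R) = E2 R.
Proof.
rewrite /E2 jordan_sq !omul0l !oip0r !oconj0 !scaler0; apply: eq_h1; rewrite ?subr0 ?addr0 //; ring.
Qed.

(** The right-hand side is E_2 when the pairing is positive and E_1 when it is negative. The element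
    transported is the idempotent g^-1 E_2. *)
Lemma E2_normal g : F4 g -> ipJ (g *m Pminus R) (E2 R) != 0 -> exists t x p, oIm p /\
  (expJ (t *: A3 (oe R 0)) *m expJ (G1 x + G2 p)) *m (invmx g *m E2 R) =
  h1 ((1 - Num.sg (ipJ (g *m Pminus R) (E2 R))) / 2)
     ((1 + Num.sg (ipJ (g *m Pminus R) (E2 R))) / 2) 0 0 0 0.
Proof.
move=> Fg; have [gU _] := Fg; have Fg' := F4_inv Fg.
have E2K : g *m (invmx g *m E2 R) = E2 R by rewrite mulKVmx.
move: E2K; move XE: (invmx g *m E2 R) => X gX.
have -> : ipJ (g *m Pminus R) (E2 R) = ipJ (Pm 1) X.
  by rewrite -gX (ipJ_F4 _ _ Fg) Pminus_Pm.
move=> m0; have [x [p [p0 [Q F]]]] := unipotent_orthogonal m0.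
have Fn := unipotent_F4 x p0; set n := expJ (G1 x + G2 p) in Q F Fn.
have XX : jordan X X = X by rewrite -XE -(proj2 Fg' (E2 R) (E2 R)) jordan_E2.
have YY : jordan (n *m X) (n *m X) = n *m X by rewrite -(proj2 Fn X X) XX.
have trY : trJ (n *m X) = 1.
  by rewrite (trJ_F4 _ Fn) -XE (trJ_F4 _ Fg') /trJ !h1_coords add0r addr0.
have mY : ipJ (Pm 1) (n *m X) = ipJ (Pm 1) X.
  by have := ipJ_F4 (Pm 1) X Fn; rewrite (unipotent_Pm x p0).
have mY0 : ipJ (Pm 1) (n *m X) != 0 by rewrite mY; exact: m0.
have [a [s [YE as2]]] := idempotent_normal YY trY Q F mY0.
have mE : ipJ (Pm 1) X = 1 - 2 * a - 2 * s.
  rewrite -mY YE /Pm ipJ_h1 !oip0r scale1r.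
  have -> : oip (oe R 0) (s *: oe R 0) = s by oct_simp; ring.
  by ring.
exists (2^-1 * ln `|1 - 2 * a - 2 * s|), x, p; split; first exact: p0.
rewrite mE -(mulmxA (expJ _)); apply: etrans (congr1 (mulmx _) YE) _.
apply: boost_normal; first exact: as2.
rewrite -mE; exact: m0.
Qed.

Lemma jordan_h1_half x : jordan (E2 R) (h1 0 0 0 x 0 0) = 2^-1 *: h1 0 0 0 x 0 0.
Proof.
rewrite /E2 jordan_h1E h1Z; oct_destruct.
by h1_field.
Qed.

Lemma jordan_E1 c d e x y z :
  jordan (h1 1 0 0 0 0 0) (h1 c d e x y z) = h1 c 0 0 0 (2^-1 *: y) (2^-1 *: z).
Proof.
rewrite jordan_h1E; do 3 oct_destruct.
by h1_field.
Qed.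

(* The Peirce 1/2-space of E_1 is negative definite for the form, that of E_2 is not. *)
Lemma E1_notin_orbit b : F4 b -> b *m E2 R <> h1 1 0 0 0 0 0.
Proof.
(* F_1^1(1) lies in the Peirce 1/2-space of E_2 and has (F|F) = 2. *)
move=> Fb bE; pose F := h1 0 0 0 (oe R 0) 0 0.
have JF : jordan (h1 1 0 0 0 0 0) (b *m F) = 2^-1 *: (b *m F).
  by rewrite -bE -(proj2 Fb (E2 R) F) jordan_h1_half scalemxAr.
have FF : ipJ (b *m F) (b *m F) = 2.
  by rewrite (ipJ_F4 _ _ Fb) ipJ_h1 !oip0r; oct_simp; ring.
move: JF FF; case: (h1P (b *m F)) => c d e x y z.
rewrite jordan_E1 h1Z => J; have [J1' J2] := (congr1 (@xi1 R) J, congr1 (@xi2 R) J).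
have [J3 J4] := (congr1 (@xi3 R) J, congr1 (@ox1 R) J).
move: J1' J2 J3 J4; rewrite !h1_coords => c0 d0 e0 x0.
have xx : oip x x = 0.
  have : 2^-1 *: x = 0 by rewrite -x0.
  by move=> /eqP; rewrite scaler_eq0 invr_eq0 pnatr_eq0 /= => /eqP ->; rewrite oip0r.
rewrite ipJ_h1 xx; have := oip_ge0 y; have := oip_ge0 z.
have -> : c = 0 by lra.
have -> : d = 0 by lra.
have -> : e = 0 by lra.
lra.
Qed.

(** A negative value would make a n g^-1 take E_2 to E_1. *)
Lemma Pminus_E2_gt0 g : F4 g -> ipJ (g *m Pminus R) (E2 R) != 0 ->
  0 < ipJ (g *m Pminus R) (E2 R).
Proof.
move=> Fg m0; have [t [x [p [p0 E]]]] := E2_normal Fg m0.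
rewrite lt_neqAle eq_sym m0 /= leNgt; apply/negP => m_lt0.
move: E; rewrite (ltr0_sg m_lt0) mulmxA => E.
apply: (E1_notin_orbit (F4_mul (F4_mul (boost_F4 t) (unipotent_F4 x p0)) (F4_inv Fg))).
by rewrite E; apply: eq_h1; [by field|by field|by []|by []|by []|by []].
Qed.

(** The sign being positive, a n g^-1 fixes E_2, so k = g (a n)^-1 lies in K_epsilon. *)
Lemma KAN_Pminus g : F4 g -> ipJ (g *m Pminus R) (E2 R) != 0 -> KAN g.
Proof.
move=> Fg m0; have [t [x [p [p0 E]]]] := E2_normal Fg m0.
move: E; rewrite (gtr0_sg (Pminus_E2_gt0 Fg m0)) => E.
set A := expJ _ in E; set n := expJ (G1 x + G2 p) in E.
have Fan : F4 (A *m n) := F4_mul (boost_F4 t) (unipotent_F4 x p0).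
have [anU _] := Fan; have [gU _] := Fg.
exists (g *m invmx (A *m n)), A, n; split.
- split; first exact: F4_mul Fg (F4_inv Fan).
  have E2E : A *m n *m (invmx g *m E2 R) = E2 R.
    by rewrite E; apply: eq_h1; [by field|by field|by []|by []|by []|by []].
  by rewrite -mulmxA -[in LHS]E2E (mulKmx anU) mulKVmx.
- by exists (t *: A3 (oe R 0)) => //; exists t.
- by exists x, p.
- by rewrite -(mulmxA (g *m _)) mulmxKV.
Qed.

End Existence.

(** * Continuity of g -> (gP^-|E_2) and the automorphism sigma *)

Section PminusCoordinate.
Variable R : realType.
Implicit Types (x y p q : oct R) (X Y Z : J1 R) (g D : endJ R) (t : R).

Lemma continuous_Pminus : continuous (fun g : endJ R => ipJ (g *m Pminus R) (E2 R)).
Proof.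
move=> g; rewrite (_ : (fun _ => _) = fun h : endJ R => (h *m Pminus R) (inord 1) 0).
  have FF : Filter (fmap (fun h : endJ R => h *m Pminus R) (nbhs g)).
    exact (@fmap_filter _ _ _ _ (nbhs_filter g)).
  have gP := @cvg_mulmx R 27 27 1 (nbhs g) g (Pminus R) (nbhs_filter g) (fun A gA => gA).
  have := @cvg_entry R 27 1 (fmap (fun h : endJ R => h *m Pminus R) (nbhs g)) _ (inord 1) 0 FF gP.
  exact.
by apply/funext => h; rewrite ipJ_E2.
Qed.

(* Conjugation by sigma takes A_3^1(1) to its opposite. *)
Definition sigma_fun X : J1 R := h1 (xi1 X) (xi2 X) (xi3 X) (ox1 X) (- ox2 X) (- ox3 X).

Definition sigma : endJ R := lin_mat sigma_fun.

Lemma sigma_h1 a b c x y z : sigma *m h1 a b c x y z = h1 a b c x (- y) (- z).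
Proof.
rewrite /sigma lin_matE; first by rewrite /sigma_fun !h1_coords.
move=> t X Y; case: (h1P X) => a1 b1 c1 x1 y1 z1; case: (h1P Y) => a2 b2 c2 x2 y2 z2.
rewrite h1Z h1D /sigma_fun !h1_coords h1Z h1D.
by rewrite !opprD -!scalerN.
Qed.

Lemma sigmaK : sigma *m sigma = 1%:M.
Proof.
apply: eq_endJ => X; rewrite -(mulmxA sigma) mul1mx; case: (h1P X) => a b c x y z.
by rewrite !sigma_h1 !opprK.
Qed.

Lemma sigma_F4 : F4 sigma.
Proof.
split; first by have [] := mulmx1_unit sigmaK.
move=> X Y; case: (h1P X) => a b c x y z; case: (h1P Y) => a' b' c' x' y' z'.
rewrite jordan_h1E !sigma_h1 jordan_h1E.
do 6 oct_destruct.
by h1_field.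
Qed.

End PminusCoordinate.

(** * Density by translation along an opposite one-parameter subgroup *)

Section Density.
Variable R : realType.
Implicit Types (x y p q : oct R) (X Y Z : J1 R) (g D : endJ R) (t : R).

(** The summand [G2 0] is zero; it puts G_1(1) in the form covered by the results on G_1(x) +
    G_2(p). *)
Definition G1_one : endJ R := G1 (oe R 0) + G2 0.

Lemma oIm0 : oIm (0 : oct R). Proof. by rewrite /oIm /ore mxE. Qed.

Lemma G1_one_h1 a b c u v w : G1_one *m h1 a b c u v w =
  h1 (- (2 * ore v)) (2 * ore u) (2 * ore v - 2 * ore u)
     ((c - b) *: oe R 0 + oconj w) ((c - a) *: oe R 0 - oconj w) (oconj v + oconj u).
Proof.
rewrite /G1_one G12_h1; do 3 oct_destruct.
by h1_field.
Qed.

(** P^+, an eigenvector of A_3^1(1) for the lowest eigenvalue -2. *)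
Let Pp : J1 R := h1 (-1) 1 0 0 0 (- oe R 0).

(** Starting from eigenvalue -2, two raisings reach eigenvalue 0; two more reach the line of P^-. *)
Lemma G1_one_Pp2 : G1_one ^+ 2 *m Pp = 2 *: h1 (-2) (-2) 4 0 0 0.
Proof.
rewrite !exprSm expr0 mul1mx /Pp !G1_one_h1 h1Z.
by h1_field.
Qed.

Lemma G1_one_Pp4 : G1_one ^+ 4 *m Pp = 24 *: Pm 1.
Proof.
rewrite (exprD _ 2 2) -mulmxA G1_one_Pp2 -scalemxAr !exprSm expr0 mul1mx !G1_one_h1 /Pm !h1Z.
by h1_field.
Qed.

Lemma sigma_Pm : sigma R *m Pm 1 = Pp.
Proof. by rewrite /Pm sigma_h1 scale1r oppr0. Qed.

Definition pencil_coef g (k : nat) : endJ R :=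
  (k`!%:R)^-1 *: (g *m sigma R *m G1_one ^+ k *m sigma R).

(* By [pencil_exp] this is g sigma exp (s G_1(1)) sigma, the right translate of g by an
   element of the unipotent group opposite to N^+. *)
Definition pencil g s : endJ R := \sum_(k < 5) s ^+ k *: pencil_coef g k.

Lemma pencil_exp g s : pencil g s = g *m sigma R *m expJ (s *: G1_one) *m sigma R.
Proof.
rewrite (@expJ_nilpotent _ _ 5); last by rewrite exprZn (G12_nilpotent _ oIm0) scaler0.
rewrite mulmx_sumr mulmx_suml; apply: eq_bigr => k _.
by rewrite /pencil_coef exprZn -!scalemxAr -!scalemxAl !scalerA mulrC.
Qed.

Lemma pencil_F4 g s : F4 g -> F4 (pencil g s).
Proof.
move=> Fg; rewrite pencil_exp; apply: F4_mul; last exact: sigma_F4.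
apply: F4_mul; first by apply: F4_mul; [exact: Fg|exact: sigma_F4].
apply: (@expJ_nilpotent_F4 _ _ 5).
  apply: derivationZ; apply: derivationD; first exact: G1_derivation.
  by apply: G2_derivation; exact: oIm0.
by rewrite exprZn (G12_nilpotent _ oIm0) scaler0.
Qed.

Lemma pencil0 g : pencil g 0 = g.
Proof.
rewrite /pencil big_ord_recl big1 ?addr0; last first.
  by move=> i _; rewrite /bump /= exprS mul0r scale0r.
rewrite expr0 scale1r /pencil_coef fact0 invr1 scale1r expr0 mulmx1.
by rewrite -mulmxA sigmaK mulmx1.
Qed.

Lemma cvg_pencil g : pencil g s @[s --> (0 : R)] --> g.
Proof.
rewrite -[X in _ --> X](pencil0 g); apply: cvg_mx_entries => i j.
change ((fun s => pencil g s i j) @ (0 : R) --> pencil g 0 i j).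
rewrite /pencil summxE (_ : (fun _ => _) = fun s => \sum_(k < 5) s ^+ k * pencil_coef g k i j).
  apply: cvg_sumr => k; have -> : (0 ^+ k *: pencil_coef g k) i j = 0 ^+ k * pencil_coef g k i j.
    by rewrite mxE.
  by apply: (cvgMl (f := fun s : R => s ^+ k)); exact: exprn_continuous.
by apply/funext => s; rewrite summxE; apply: eq_bigr => k _; rewrite mxE.
Qed.

(** sigma takes P^- to P^+, so the coefficients come from the vectors G_1(1)^k P^+. *)
Lemma pencil_coef_Pminus g k Z : G1_one ^+ k *m Pp = Z ->
  ipJ (pencil_coef g k *m Pminus R) (E2 R) = (k`!%:R)^-1 * ipJ (g *m (sigma R *m Z)) (E2 R).
Proof.
move=> DZ; rewrite /pencil_coef -scalemxAl ipJZl.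
have -> : g *m sigma R *m G1_one ^+ k *m sigma R *m Pminus R = g *m (sigma R *m Z); last by [].
rewrite -(mulmxA (g *m sigma R *m G1_one ^+ k)) Pminus_Pm sigma_Pm.
by rewrite -(mulmxA (g *m sigma R)) DZ -(mulmxA g).
Qed.

Lemma pencil_coef0 g : pencil_coef g 0 = g.
Proof.
rewrite /pencil_coef fact0 invr1 scale1r expr0 mulmx1 -(mulmxA g (sigma R) (sigma R)).
by rewrite sigmaK mulmx1.
Qed.

Lemma pencil_coef2 g :
  ipJ (pencil_coef g 2 *m Pminus R) (E2 R) = ipJ (g *m h1 (-2) (-2) 4 0 0 0) (E2 R).
Proof.
rewrite (pencil_coef_Pminus g G1_one_Pp2) -scalemxAr sigma_h1 !oppr0 -scalemxAr ipJZl mulrA.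
by rewrite (_ : (2`!%:R)^-1 * 2 = 1) ?mul1r // mulVf // pnatr_eq0.
Qed.

Lemma pencil_coef4 g : ipJ (pencil_coef g 4 *m Pminus R) (E2 R) = ipJ (g *m Pp) (E2 R).
Proof.
rewrite (pencil_coef_Pminus g G1_one_Pp4) -scalemxAr sigma_Pm -scalemxAr ipJZl mulrA.
by rewrite (_ : (4`!%:R)^-1 * 24 = 1) ?mul1r // mulVf // pnatr_eq0.
Qed.

Lemma pencil_Pminus g s : ipJ (pencil g s *m Pminus R) (E2 R) =
  \sum_(k < 5) s ^+ k * ipJ (pencil_coef g k *m Pminus R) (E2 R).
Proof.
have J0 : ipJ 0 (E2 R) = 0 by have := ipJZl 0 0 (E2 R); rewrite scale0r mul0r.
rewrite /pencil mulmx_suml (big_morph (fun Z => ipJ Z (E2 R)) (fun Z Z' => ipJDl Z Z' _) J0).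
by apply: eq_bigr => k _; rewrite -scalemxAl ipJZl.
Qed.

(** Adding the values at h and -h, and those at h/2 and -h/2, isolates the even part: two
    independent linear equations in c_2 and c_4. *)
Lemma quartic_coef_eq0 (c : nat -> R) (h : R) : h != 0 -> c 0%N = 0 ->
  (forall s, `|s| <= `|h| -> \sum_(k < 5) s ^+ k * c k = 0) -> c 2%N = 0 /\ c 4%N = 0.
Proof.
move=> h0 c0 ch.
have E s : `|s| <= `|h| -> s * c 1%N + s ^+ 2 * c 2%N + s ^+ 3 * c 3%N + s ^+ 4 * c 4%N = 0.
  by move=> /ch; rewrite !big_ord_recl big_ord0 /bump /= c0 => e; rewrite -{}[RHS]e; ring.
have hh : `|h / 2| <= `|h|.
  by rewrite normrM [`|2^-1|]gtr0_norm ?invr_gt0 //; have := normr_ge0 h; lra.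
have q1 := E h (lexx _); have q2 : _ := E (- h); rewrite normrN in q2; have {}q2 := q2 (lexx _).
have q3 := E _ hh; have q4 : _ := E (- (h / 2)); rewrite normrN in q4; have {}q4 := q4 hh.
have h20 : h ^+ 2 != 0 by rewrite expf_neq0.
have c4 : c 4%N = 0.
  by do 2 apply: (mulfI h20); rewrite !mulr0; lra.
split=> //; apply: (mulfI h20); rewrite mulr0; move: q1 q2; rewrite c4; lra.
Qed.

(* The coordinates of the idempotent g^-1 E_2 that these three equations force, together with
   its trace, are xi_1 = xi_2 = xi_3 = 1/3; but an idempotent has xi_1 <= xi_1 ^+ 2. *)
Lemma E2_coords_not_all_eq0 g : F4 g -> ipJ (g *m Pm 1) (E2 R) = 0 ->
  ipJ (g *m h1 (-2) (-2) 4 0 0 0) (E2 R) = 0 -> ipJ (g *m Pp) (E2 R) = 0 -> False.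
Proof.
move=> Fg; have [gU _] := Fg; have Fg' := F4_inv Fg.
have gX : g *m (invmx g *m E2 R) = E2 R by rewrite mulKVmx.
have XX : jordan (invmx g *m E2 R) (invmx g *m E2 R) = invmx g *m E2 R.
  by rewrite -(proj2 Fg' (E2 R) (E2 R)) jordan_E2.
have trX : trJ (invmx g *m E2 R) = 1 by rewrite (trJ_F4 _ Fg') /trJ !h1_coords add0r addr0.
move: gX XX trX; move: (invmx g *m E2 R) => X gX XX trX.
rewrite -gX !(ipJ_F4 _ _ Fg); move: XX trX; clear; case: (h1P X) => a b d x y z.
rewrite /trJ /Pp /Pm !ipJ_h1 !h1_coords jordan_sq => /(congr1 (@xi1 R)); rewrite !h1_coords scale1r.
rewrite (oipC 0 x) (oipC 0 y) (oipC 0 z) !oip0r oip1l.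
have -> : oip (- oe R 0) z = - ore z by rewrite -scaleN1r oipZl oip1l mulN1r.
move=> E tr E1 E3 E4.
have a3 : a = 3^-1 by lra.
have := oip_ge0 y; have := oip_ge0 z; move: E; rewrite a3; lra.
Qed.

(** If a neighbourhood of g missed [KAN], the quartic (pencil g s P^-|E_2) would vanish for small s.
    Its coefficients of degree 0, 2 and 4 then give the equations excluded by
    [E2_coords_not_all_eq0]. *)
Lemma F4_sub_closure_KAN : @F4 R `<=` closure (@KAN R).
Proof.
move=> g Fg B gB.
have [m0|m0] := eqVneq (ipJ (g *m Pminus R) (E2 R)) 0; last first.
  by exists g; split; [exact: KAN_Pminus|exact: nbhs_singleton].
have /nbhs_ballP[e /= e0 eB] : nbhs (0 : R) (fun s => B (pencil g s)) := cvg_pencil gB.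
apply: contrapT => noB.
have f0 s : `|s| < e -> ipJ (pencil g s *m Pminus R) (E2 R) = 0.
  move=> se; apply/eqP; apply: contraT => fs; case: noB; exists (pencil g s); split.
    by apply: KAN_Pminus fs; exact: pencil_F4.
  by apply: eB; rewrite /ball /= sub0r normrN.
have h0 : e / 2 != 0 by rewrite gt_eqF // divr_gt0.
have [] := @quartic_coef_eq0 (fun k => ipJ (pencil_coef g k *m Pminus R) (E2 R)) (e / 2) h0.
- by rewrite pencil_coef0; exact: m0.
- move=> s sh; rewrite -pencil_Pminus; apply: f0; apply: le_lt_trans sh _.
  by rewrite gtr0_norm ?divr_gt0 //; lra.
move=> c2 c4; have m1 : ipJ (g *m Pm 1) (E2 R) = 0 by rewrite -Pminus_Pm; exact: m0.
apply: (E2_coords_not_all_eq0 Fg m1 (etrans (esym (pencil_coef2 g)) c2)).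
exact: (etrans (esym (pencil_coef4 g)) c4).
Qed.

End Density.

(** * Assembly of the description of K_epsilon A N^+, its openness and density, and the unique
    factorization *)

Theorem theorem9p6 (R : realType) :
  [/\ @KAN R = [set g | F4 g /\ ipJ (g *m Pminus R) (E2 R) != 0],
      [set g | F4 g /\ ipJ (g *m Pminus R) (E2 R) != 0]
        = [set g | F4 g /\ 0 < ipJ (g *m Pminus R) (E2 R)],
      (exists2 U : set (endJ R), open U & @KAN R = @F4 R `&` U),
      @F4 R `<=` closure (@KAN R) &
      forall g : endJ R, KAN g ->
        (exists! kHn : endJ R * endJ R * endJ R,
           iwasawa g kHn.1.1 kHn.1.2 kHn.2) /\
        (forall k H n : endJ R, iwasawa g k H n ->
           [/\ H = H_eps g, n = n_eps g & k = k_eps g])].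
Proof.
have KANP (g : endJ R) : KAN g <-> exists k H n, iwasawa g k H n.
  split=> [[k [a [n [Kk [H HA <-] Nn ->]]]]|[k [H [n [Kk HA Nn ->]]]]].
    by exists k, H, n; split.
  by exists k, (expJ H), n; split=> //; exists H.
have KANE : @KAN R = [set g | F4 g /\ ipJ (g *m Pminus R) (E2 R) != 0].
  apply/seteqP; split=> [g /KANP [k [H [n W]]]|g [Fg m0]]; last exact: KAN_Pminus.
  by split; [exact: iwasawa_F4 W|rewrite gt_eqF // (iwasawa_gt0 W)].
split; first exact: KANE.
- apply/seteqP; split=> g [Fg m0]; split=> //; first exact: Pminus_E2_gt0.
  by rewrite gt_eqF.
(* The open set is taken among all linear maps, where the pairing is already continuous. *)
- exists [set g | ipJ (g *m Pminus R) (E2 R) != 0].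
    apply: (@open_comp _ _ (fun g : endJ R => ipJ (g *m Pminus R) (E2 R)) [set r | r != 0]).
      by move=> g _; exact: continuous_Pminus.
    exact: open_neq.
  by rewrite KANE.
- exact: F4_sub_closure_KAN.
move=> g /KANP [k [H [n W]]]; split; last by move=> k' H' n'; exact: iwasawa_unique.
exists (k, H, n); split=> [|[[k' H'] n'] W']; first exact: W.
(* Both triples equal the one given by the explicit formulas in g. *)
have [-> -> ->] := iwasawa_unique W.
by have [/= -> -> ->] := iwasawa_unique W'.
Qed.
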